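(* Let $r,s,d,k,n$ be integers with $0\le s\le r-2$, $d>k\ge0$ and $n\ge 0$. Let $\mathbb{K}$ be an algebraically closed field with $\operatorname{char}(\mathbb{K})=p>0$. Then the evaluation morphism $$\rho\colon\mathcal{M}_{0,n}(X_{r,s},(d,k))\to(X_{r,s})^n$$ is dominant over $\mathbb{C}$ (or equivalently over $\mathbb{Q}$) if and only if it is dominant over $\mathbb{K}$.
   Context: $X_{r,s}=\mathrm{Bl}_{\mathbb{P}^s}(\mathbb{P}^r)$ is the blow-up of $\mathbb{P}^r$ along a (coordinate) linear subspace $\mathbb{P}^s$. A map $f$ from a smooth rational curve $C$ to $X_{r,s}$ has degree $(d,k)$ if the hyperplane class pulled back from $\mathbb{P}^r$ has degree $d$ and the exceptional divisor has degree $k$ on $C$. $\mathcal{M}_{0,n}(X_{r,s},(d,k))$ is the moduli space of $n$-pointed maps $(C;p_1,\dots,p_n;f)$ from a smooth rational curve to $X_{r,s}$ of degree $(d,k)$, with the $p_i$ distinct, and $\rho$ sends such data to $(f(p_1),\dots,f(p_n))$. Both $X_{r,s}$ and $\mathcal{M}_{0,n}(X_{r,s},(d,k))$ are defined over $\mathbb{Z}$, and ''over'' a field means after base change to that field. *)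

(* Defs.v *)
From HB Require Import structures.
From mathcomp Require Import all_boot all_order all_algebra all_field.
From mathcomp Require Import reals complex mpoly.

Set Implicit Arguments.
Unset Strict Implicit.
Unset Printing Implicit Defensive.

Import GRing.Theory.
Local Open Scope ring_scope.

(* Points of projective spaces are given by nonzero row vectors (homogeneous
   coordinates); two such vectors are the same point when [proj_eq] holds. *)
Definition proj_eq (L : fieldType) (m : nat) (v w : 'rV[L]_m) : Prop :=
  exists2 c : L, c != 0 & v = c *: w.

(* The coordinates x_(s+1), ..., x_r, whose common zero locus is P^s. *)
Definition normal_idx (r s : nat) (j : 'I_(r - s)) : 'I_r.+1 :=
  inord (s.+1 + j).

(* Bl_(P^s)(P^r) as a closed subvariety of P^r x P^(r-s-1): the closure of the
   graph of the linear projection away from P^s.  The ideal of P^s is generated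
   by the regular sequence x_(s+1), ..., x_r, so the Rees algebra is cut out by
   the 2 x 2 minors below. *)
Definition blowup_pt (L : fieldType) (r s : nat)
    (x : 'rV[L]_r.+1) (y : 'rV[L]_(r - s)) : Prop :=
  [/\ x != 0, y != 0 &
      forall i j : 'I_(r - s),
        x 0 (normal_idx i) * y 0 j = x 0 (normal_idx j) * y 0 i].

Definition eval_forms (L : fieldType) (m : nat) (F : 'I_m -> {mpoly L[2]})
    (u : 'rV[L]_2) : 'rV[L]_m :=
  \row_j (F j).@[u 0].

(* A morphism P^1 -> Bl_(P^s)(P^r) of degree (d, k), as a pair of morphisms
   P^1 -> P^r and P^1 -> P^(r-s-1) given by binary forms.  On the blow-up the
   local equations e of the exceptional divisor E are glued by
   x_(s+1+j) = e * y_j, so O(E) = O(1, -1); hence f^*O(E) has degree k exactly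
   when the forms y_j have degree d - k.  This includes curves lying in E
   (where f^*e = 0). *)
Definition is_map (L : fieldType) (r s d k : nat)
    (F : 'I_r.+1 -> {mpoly L[2]}) (G : 'I_(r - s) -> {mpoly L[2]}) : Prop :=
  [/\ forall j, F j \is d.-homog,
      forall j, G j \is (d - k).-homog &
      forall u : 'rV[L]_2, u != 0 ->
        blowup_pt (eval_forms F u) (eval_forms G u)].

(* The n rows of z are n distinct points of P^1. *)
Definition distinct_pts (L : fieldType) (n : nat) (z : 'M[L]_(n, 2)) : Prop :=
  (forall i, row i z != 0) /\
  (forall i j, i != j -> ~ proj_eq (row i z) (row j z)).

(* The point of (X_(r,s))^n with homogeneous coordinates (x, y) (one row for
   each factor) is (f(p_1), ..., f(p_n)) for some L-point (C; p_1, ..., p_n; f)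
   of the moduli space.  L is meant to be algebraically closed, so that C may be
   taken to be P^1. *)
Definition in_ev_image (L : fieldType) (r s d k n : nat)
    (x : 'M[L]_(n, r.+1)) (y : 'M[L]_(n, r - s)) : Prop :=
  exists (F : 'I_r.+1 -> {mpoly L[2]}) (G : 'I_(r - s) -> {mpoly L[2]})
         (z : 'M[L]_(n, 2)),
    [/\ is_map d k F G, distinct_pts z &
        forall i, proj_eq (row i x) (eval_forms F (row i z)) /\
                  proj_eq (row i y) (eval_forms G (row i z))].

(* The polynomial P in the homogeneous coordinates of (P^r x P^(r-s-1))^n is
   homogeneous of degree a i in the x-coordinates and of degree b i in the
   y-coordinates of the i-th factor. *)
Definition multihomog (F : fieldType) (r s n : nat) (a b : 'I_n -> nat)
    (P : {mpoly F[n * (r.+1 + (r - s))]}) : Prop :=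
  forall m, m \in msupp P -> forall i : 'I_n,
    (\sum_(j < r.+1) m (mxvec_index i (lshift (r - s) j)) = a i)%N /\
    (\sum_(j < r - s) m (mxvec_index i (rshift r.+1 j)) = b i)%N.

Definition vanishes_at (F L : fieldType) (iota : {rmorphism F -> L})
    (r s n : nat) (P : {mpoly F[n * (r.+1 + (r - s))]})
    (x : 'M[L]_(n, r.+1)) (y : 'M[L]_(n, r - s)) : Prop :=
  (map_mpoly iota P).@[mxvec (row_mx x y) 0] = 0.

(* The evaluation morphism is dominant over F, where iota embeds F in an
   algebraically closed field L: every closed subset of (X_(r,s))^n defined over
   F that contains the image of all L-points of the moduli space is all of
   (X_(r,s))^n.  Since the moduli space is of finite type over F, its L-points
   are dense in it and this is density of the scheme-theoretic image. *)
Definition ev_dominant (F : fieldType) (L : closedFieldType)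
    (iota : {rmorphism F -> L}) (r s d k n : nat) : Prop :=
  forall (a b : 'I_n -> nat) (P : {mpoly F[n * (r.+1 + (r - s))]}),
    multihomog a b P ->
    (forall x y, in_ev_image d k x y -> vanishes_at iota P x y) ->
    forall (x : 'M[L]_(n, r.+1)) (y : 'M[L]_(n, r - s)),
      (forall i, blowup_pt (row i x) (row i y)) -> vanishes_at iota P x y.

Definition ev_dominant_closed (L : closedFieldType) (r s d k n : nat) : Prop :=
  @ev_dominant L L idfun r s d k n.

Definition ev_dominant_rat (r s d k n : nat) : Prop :=
  @ev_dominant rat algC ratr r s d k n.

(* Main.v *)
Require Import Defs.
From HB Require Import structures.
From mathcomp Require Import all_boot all_order all_algebra all_field.
From mathcomp Require Import boolp reals complex mpoly ring zify.

Set Implicit Arguments.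
Unset Strict Implicit.
Unset Printing Implicit Defensive.

Import Order.TTheory GRing.Theory.
Local Open Scope ring_scope.

(** Why the theorem is true.

    A curve on Bl_(P^s)(P^r) has Cox coordinates: forms X_0, ..., X_s of degree
    d, a form E of degree k and forms Y_j of degree d - k, the map to P^r being
    (X_0 : ... : X_s : E Y_0 : E Y_1 : ...).  Over an algebraically closed field
    these forms split, so after rescaling the representative of each image
    point, the values at the marked points t_i are
      lambda_i^(0 or 1) mu_i^(0 or 1) c_q prod_l (t_i - rho_(q,l)),
    that is, products of differences of points a_v of the affine line, where
    lambda_i, mu_i and c_q count as differences with the point 0.  Dominance over
    a field F says exactly that these products, for independent variables a_v,
    are algebraically independent over F ([dominant_independent] and
    [independent_dominant]).  It remains to see that algebraic independence of
    products of differences does not depend on the field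
    ([diff_prod_independence_transfer]).

    This is an instance of the fact that the tropicalization of the image of a
    monomial map from the complement of the braid arrangement does not depend on
    the characteristic.  Let the products f_1, ..., f_D be independent over F.
    Monomials in them are ordered by a monomial order, which gives a valuation
    on F(f_1, ..., f_D) for which distinct monomials in the f_j have distinct
    values; extend it to a field containing the a_v.  The differences a_v - a_w
    then form an ultrametric, encoded by a tree: every point v is attached to
    the nearest earlier point, and every a_v - a_w has the value of one of the
    edges u_v of the tree.  Over any other field F', put independent variables
    T_v on the edges of the same tree, ordered like the values of the u_v, and
    let b_v be the sum of the T along the path from v to the root.  The leading
    monomial of b_v - b_w is the variable of the edge whose value is that of
    a_v - a_w.  Hence distinct monomials in the new products of differences have
    distinct leading monomials, and no polynomial relation can hold.

    Only finitely many ratios of differences have to be compared, so the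
    extension of the valuation is replaced by finitely many applications of the
    exchange argument of Chevalley's extension theorem
    ([valuation_extension]). *)

(** * Extending a proper ideal to a valuation *)

(** A stand-in for a valuation: [A] plays the valuation ring and [I] a proper
    ideal of it; only finitely many divisibilities have to be decided by [A]. *)
Record proper_pair (L : fieldType) (A I : L -> Prop) : Prop := ProperPair {
  pair_1 : A 1;
  pairB : forall x y, A x -> A y -> A (x - y);
  pairM : forall x y, A x -> A y -> A (x * y);
  pair_sub : forall x, I x -> A x;
  pairI0 : I 0;
  pairIB : forall x y, I x -> I y -> I (x - y);
  pairIM : forall x y, A x -> I y -> I (x * y);
  pair_proper : ~ I 1 }.

Section ProperPair.

Variables (L : fieldType) (A I : L -> Prop).
Hypothesis AI : proper_pair A I.

Lemma pairD x y : A x -> A y -> A (x + y).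
Proof.
move=> Ax Ay; rewrite -[y]opprK; apply: (pairB AI) => //.
rewrite -[- y]sub0r; apply: (pairB AI) => //.
exact/(pair_sub AI)/(pairI0 AI).
Qed.

Lemma pairID x y : I x -> I y -> I (x + y).
Proof.
move=> Ix Iy; rewrite -[y]opprK; apply: (pairIB AI) => //.
by rewrite -[- y]sub0r; apply: (pairIB AI) => //; apply: (pairI0 AI).
Qed.

(** The exchange step of Chevalley's theorem.  Write 1 = sum_i p_i x^i and
    1 - q_0 = sum_(j > 0) q_j x^(-j).  Multiply the first equation by 1 - q_0 and
    substitute the second into its top term: the power x^(n+1) disappears and all
    coefficients stay in [I]. *)
Lemma unit_certificate_descent (x : L) (n : nat) (p q : {poly L}) :
  x != 0 -> (size p <= n.+2)%N -> (size q <= n.+2)%N ->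
  (forall i, I p`_i) -> (forall i, I q`_i) -> p.[x] = 1 -> q.[x^-1] = 1 ->
  exists p' : {poly L}, [/\ (size p' <= n.+1)%N, forall i, I p'`_i & p'.[x] = 1].
Proof.
move=> x0 sp sq Ip Iq px qx.
(* q' = x^(n+1) (q(1/x) - q_0) as a polynomial in x. *)
pose q' := \poly_(i < n.+1) q`_(n.+1 - i).
have q'x : q'.[x] = x ^+ n.+1 * (1 - q`_0).
  rewrite -{1}qx (horner_coef_wide _ sq) big_ord_recl /= expr0 mulr1.
  rewrite [q`_0 + _]addrC addrK mulr_sumr horner_poly.
  rewrite (reindex_inj rev_ord_inj); apply: eq_bigr => i _ /=.
  rewrite /bump /= add1n mulrCA subKn ?(leqW (ltn_ord _)) //.
  congr (_ * _); rewrite subSS exprVn.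
  apply: (canRL (mulfK _)); first by rewrite expf_neq0.
  by rewrite -exprD addnS subnK // -ltnS.
pose p' := take_poly n.+1 p.
have pE : p = p' + p`_n.+1 *: 'X^(n.+1).
  apply/polyP => i; rewrite coefD coef_take_poly coefZ coefXn.
  case: (ltngtP i n.+1) => [lt|gt|->]; rewrite ?mulr0 ?mulr1 ?addr0 ?add0r //.
  by rewrite nth_default // (leq_trans sp).
have p'x : p'.[x] = 1 - p`_n.+1 * x ^+ n.+1.
  by move: px; rewrite {1}pE hornerD hornerZ hornerXn => <-; rewrite addrK.
exists ((q`_0)%:P + (1 - q`_0) *: p' + p`_n.+1 *: q'); split.
- apply: leq_trans (size_polyD _ _) _; rewrite geq_max; apply/andP; split.
    apply: leq_trans (size_polyD _ _) _; rewrite geq_max; apply/andP; split.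
      by apply: leq_trans (size_polyC_leq1 _) _.
    by apply: leq_trans (size_scale_leq _ _) _; apply: size_take_poly.
  by apply: leq_trans (size_scale_leq _ _) _; apply: size_poly.
- move=> i; rewrite !coefD !coefZ coefC.
  apply: (pairID); last first.
    apply: (pairIM AI) (pair_sub AI (Ip _)) _ => //; rewrite coef_poly.
    by case: ifP => // _; apply: (pairI0 AI).
  apply: (pairID); first by case: ifP => // _; apply: (pairI0 AI).
  apply: (pairIM AI).
    by apply: (pairB AI); [apply: (pair_1 AI) | apply: (pair_sub AI)].
  by rewrite coef_take_poly; case: ifP => // _; apply: (pairI0 AI).
- by rewrite 2!hornerD !hornerZ hornerC q'x p'x; ring.
Qed.

End ProperPair.

(** If [I] generated the unit ideal both in A[x] and in A[1/x], the descent,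
    applied to the relation of larger degree, would end with 1 in [I]. *)
Lemma no_two_unit_certificates (L : fieldType) (A I : L -> Prop) (N : nat)
    (x : L) (p q : {poly L}) :
  proper_pair A I -> x != 0 -> (size p + size q <= N)%N ->
  (forall i, I p`_i) -> (forall i, I q`_i) -> p.[x] = 1 -> q.[x^-1] = 1 -> False.
Proof.
move=> AI; elim: N x p q => [|N IH] x p q x0.
  rewrite leqn0 addn_eq0 !size_poly_eq0 => /andP[/eqP-> _] _ _ /eqP.
  by rewrite horner0 eq_sym oner_eq0.
wlog le_qp : x p q x0 / (size q <= size p)%N => [wl|].
  case: (leqP (size q) (size p)) => [/wl|/ltnW le_pq]; first exact.
  move=> spq Ip Iq px qx; apply: (wl x^-1 q p) => //; rewrite ?invr_eq0 ?invrK //.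
  by rewrite addnC.
move=> spq Ip Iq px qx.
case: (leqP (size p) 1) => [/size1_polyC pC|].
  by apply: (pair_proper AI); rewrite -px pC hornerC; apply: Ip.
case Ep: (size p) => [|[|n]] // _.
have sp : (size p <= n.+2)%N by rewrite Ep.
have sq : (size q <= n.+2)%N by rewrite -Ep.
have [p' [sp' Ip' p'x]] := unit_certificate_descent AI x0 sp sq Ip Iq px qx.
apply: (IH x p' q x0 _ Ip' Iq p'x qx).
by rewrite -ltnS (leq_trans _ spq) // ltn_add2r Ep.
Qed.

Definition adjoin (L : fieldType) (B : L -> Prop) (x z : L) : Prop :=
  exists2 p : {poly L}, (forall i, B p`_i) & z = p.[x].

Lemma adjoin_sub (L : fieldType) (B : L -> Prop) (x z : L) :
  B 0 -> B z -> adjoin B x z.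
Proof.
move=> B0 Bz; exists z%:P => [i|]; last by rewrite hornerC.
by rewrite coefC; case: ifP.
Qed.

Lemma proper_pair_adjoin (L : fieldType) (A I : L -> Prop) (x : L) :
  proper_pair A I -> ~ adjoin I x 1 -> proper_pair (adjoin A x) (adjoin I x).
Proof.
move=> AI I1.
have A0 : A 0 by apply/(pair_sub AI)/(pairI0 AI).
split=> //.
- by apply: adjoin_sub => //; apply: (pair_1 AI).
- move=> _ _ [p Ap ->] [q Aq ->]; exists (p - q); rewrite ?hornerE // => i.
  by rewrite coefB; apply: (pairB AI).
- move=> _ _ [p Ap ->] [q Aq ->]; exists (p * q); rewrite ?hornerE // => i.
  rewrite coefM; elim/big_rec: _ => [|j z _ Az] //.
  by apply: (pairD AI) => //; apply: (pairM AI).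
- move=> _ [p Ip ->]; exists p => // i; exact: (pair_sub AI).
- by apply: adjoin_sub => //; apply: (pairI0 AI).
- move=> _ _ [p Ap ->] [q Aq ->]; exists (p - q); rewrite ?hornerE // => i.
  by rewrite coefB; apply: (pairIB AI).
- move=> _ _ [p Ap ->] [q Aq ->]; exists (p * q); rewrite ?hornerE // => i.
  rewrite coefM; elim/big_rec: _ => [|j z _ Az]; first exact: (pairI0 AI).
  by apply: (pairID AI) => //; apply: (pairIM AI).
Qed.

(** Adjoining x or 1/x for each of the finitely many elements of [s] replaces the
    appeal to Zorn's lemma for a valuation ring dominating [A]. *)
Lemma valuation_extension (L : fieldType) (A I : L -> Prop) (s : seq L) :
  proper_pair A I -> exists A' I' : L -> Prop,
  [/\ proper_pair A' I', forall x, I x -> I' x, forall x, A x -> A' x &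
      forall x, x \in s -> A' x \/ A' x^-1].
Proof.
elim: s A I => [|x s IH] A I AI; first by exists A, I; split.
suff [A1 [I1 [AI1 sI sA A1x]]] : exists A1 I1 : L -> Prop,
  [/\ proper_pair A1 I1, forall x, I x -> I1 x, forall x, A x -> A1 x &
      A1 x \/ A1 x^-1].
  have [A2 [I2 [AI2 sI2 sA2 A2s]]] := IH _ _ AI1.
  exists A2, I2; split => // [z /sI/sI2 //|z /sA/sA2 //|z].
  rewrite inE => /predU1P[->|/A2s //].
  by case: A1x => /sA2; [left|right].
have A0 : A 0 by apply/(pair_sub AI)/(pairI0 AI).
have adjx y : adjoin A y y.
  exists 'X; rewrite ?hornerX // => i; rewrite coefX.
  by case: eqP => _ //; apply: (pair_1 AI).
have [x0|x0] := eqVneq x 0.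
  by exists A, I; split=> //; left; rewrite x0.
have [[p Ip px]|I1] := pselect (adjoin I x 1).
  exists (adjoin A x^-1), (adjoin I x^-1); split; last by right.
  - apply: (proper_pair_adjoin AI) => -[q Iq qx].
    exact: (no_two_unit_certificates AI x0 (leqnn _) Ip Iq).
  - by move=> z; apply: adjoin_sub => //; apply: (pairI0 AI).
  - by move=> z; apply: adjoin_sub.
exists (adjoin A x), (adjoin I x); split; last by left.
- exact: (proper_pair_adjoin AI).
- by move=> z; apply: adjoin_sub => //; apply: (pairI0 AI).
- by move=> z; apply: adjoin_sub.
Qed.

(** * Products of differences of points *)

Lemma msuppM_bound (F : fieldType) (D : nat) (P1 P2 P3 : 'X_{1..D} -> Prop)
    (p q : {mpoly F[D]}) :
  (forall m, m \in msupp p -> P1 m) -> (forall m, m \in msupp q -> P2 m) ->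
  (forall m1 m2, P1 m1 -> P2 m2 -> P3 (m1 + m2)%MM) ->
  forall m, m \in msupp (p * q) -> P3 m.
Proof.
move=> P1p P2q P12 m /msuppM_le /allpairsP[[m1 m2] /= [m1p m2q ->]].
by apply: P12; [apply: P1p | apply: P2q].
Qed.

Section BoundedFractions.

Variables (F L : fieldType) (iota : {rmorphism F -> L}) (D : nat).
Variable f : 'I_D -> L.

(** The fractions p(f) / f^M all of whose monomials are below M.  For independent
    [f], the order [<=%O] gives the ring of a valuation of F(f) with values in
    the monomials, and [<%O] its maximal ideal, cut down to denominators that are
    monomials. *)
Definition bounded_fraction (r : rel 'X_{1..D}) (x : L) : Prop :=
  exists p M, (forall m, m \in msupp p -> r m M) /\
              x * mmap1 f M = mmap iota f p.

Let mmapXM m (p : {mpoly F[D]}) :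
  mmap iota f (p * 'X_[m]) = mmap iota f p * mmap1 f m.
Proof. by rewrite rmorphM /= mmapX. Qed.

Let mmap1M m m' : mmap1 f (m + m')%MM = mmap1 f m * mmap1 f m'.
Proof. by apply: commr_mmap1_M => i x; apply: mulrC. Qed.

Lemma bounded_fractionB (r : rel 'X_{1..D}) :
  (forall m M k, r m M -> r (m + k)%MM (M + k)%MM) ->
  forall x y, bounded_fraction r x -> bounded_fraction r y ->
  bounded_fraction r (x - y).
Proof.
move=> rD x y [p [M [pM px]]] [q [N [qN qy]]].
exists (p * 'X_[N] - q * 'X_[M]), (M + N)%MM; split; last first.
  by rewrite rmorphB /= !mmapXM mmap1M -px -qy; ring.
move=> m /msuppB_le; rewrite mem_cat => /orP[]; move: m.
- apply: (msuppM_bound pM (P2 := fun k => k = N)) => [k|m1 m2 h ->].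
    by rewrite msuppX inE => /eqP.
  exact: rD.
- apply: (msuppM_bound qN (P2 := fun k => k = M)) => [k|m1 m2 h ->].
    by rewrite msuppX inE => /eqP.
  by rewrite [(M + N)%MM]addmC; apply: rD.
Qed.

Lemma bounded_fractionM (r r' r'' : rel 'X_{1..D}) :
  (forall m M k K, r m M -> r' k K -> r'' (m + k)%MM (M + K)%MM) ->
  forall x y, bounded_fraction r x -> bounded_fraction r' y ->
  bounded_fraction r'' (x * y).
Proof.
move=> rM x y [p [M [pM px]]] [q [N [qN qy]]].
exists (p * q), (M + N)%MM; split; last first.
  by rewrite rmorphM /= mmap1M -px -qy; ring.
by apply: (msuppM_bound pM qN) => m1 m2; apply: rM.
Qed.

Hypothesis f_indep : forall P : {mpoly F[D]}, mmap iota f P = 0 -> P = 0.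

(** 1 is not in the ideal: p(f) = f^M with all monomials of p below M would be a
    nontrivial relation between the f_j. *)
Lemma bounded_fraction_proper :
  proper_pair (bounded_fraction <=%O) (bounded_fraction <%O).
Proof.
split.
- exists 1, 0%MM; rewrite mmap11 mulr1 rmorph1; split=> // m.
  by rewrite msupp1 inE => /eqP->.
- by apply: bounded_fractionB => m M k; rewrite lemc_add2l.
- by apply: bounded_fractionM => m M k K; apply: lem_add.
- by move=> x [p [M [pM px]]]; exists p, M; split=> // m /pM/ltW.
- by exists 0, 0%MM; rewrite mul0r rmorph0 msupp0.
- by apply: bounded_fractionB => m M k; rewrite ltmc_add2l.
- by apply: bounded_fractionM => m M k K; apply: lemc_lt_add.
- move=> [p [M [pM]]]; rewrite mul1r => /eqP.
  rewrite -(mmapX f iota) -subr_eq0 -rmorphB => /eqP /f_indep /eqP.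
  rewrite subr_eq0 => /eqP XE.
  by have := pM M; rewrite -XE msuppX inE eqxx ltxx => /(_ isT).
Qed.

(** Distinct monomials in the f_j have distinct values. *)
Lemma monomial_bounded_fraction (m m' : 'X_{1..D}) :
  mmap1 f m' != 0 -> (m < m')%O ->
  bounded_fraction <%O (mmap1 f m / mmap1 f m').
Proof.
move=> m'0 lt; exists 'X_[m], m'; split; last by rewrite mmapX divfK.
by move=> k; rewrite msuppX inE => /eqP->.
Qed.

End BoundedFractions.

Lemma sum_distinct_mlead_neq0 (R : idomainType) (n : nat) (T : eqType)
    (r : seq T) (F : T -> {mpoly R[n]}) :
  r != [::] -> (forall x, x \in r -> F x != 0) -> uniq ([seq mlead (F x) | x <- r]) ->
  \sum_(x <- r) F x != 0.
Proof.
move=> r0 F0 Fu.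
suff [] : \sum_(x <- r) F x != 0 /\ mlead (\sum_(x <- r) F x) \in [seq mlead (F x) | x <- r].
  by [].
elim: r r0 F0 Fu => // x [|y s] IH _ F0.
  by rewrite big_seq1 /= mem_head F0 ?mem_head.
rewrite big_cons map_cons cons_uniq => /andP[xF /IH[//|z zs|S0 Sm]].
  by apply: F0; rewrite inE zs orbT.
have ne : mlead (F x) != mlead (\sum_(z <- y :: s) F z).
  by apply: contraNneq xF => /= ->.
split.
  apply: contra_neq ne => /eqP; rewrite addr_eq0 => /eqP->; exact: mleadN.
rewrite mleadD // in_cons /=; case: (leP _ (mlead (F x))) => _; rewrite ?eqxx //.
by rewrite Sm orbT.
Qed.

Lemma seq_max (T : eqType) (R : T -> T -> Prop) (x : T) (s : seq T) :
  (forall y z, R y z \/ R z y) -> (forall y z t, R y z -> R z t -> R y t) ->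
  exists2 y, y \in x :: s & forall z, z \in x :: s -> R z y.
Proof.
move=> Rtot Rtr; have Rrefl y : R y y by case: (Rtot y y).
elim: s x => [|y s IH] x.
  by exists x => [|z]; rewrite ?mem_head // inE => /eqP->.
have [w ws wmax] := IH y; case: (Rtot x w) => xw.
  exists w => [|z]; first by rewrite inE ws orbT.
  by rewrite inE => /predU1P[->|/wmax].
exists x => [|z]; first exact: mem_head.
by rewrite inE => /predU1P[->|/wmax/Rtr]; last exact.
Qed.

Lemma sorted_enumeration (V : finType) (leV : rel V) :
  total leV -> transitive leV ->
  exists (sigma : 'I_#|V| -> V) (tau : V -> 'I_#|V|),
    [/\ cancel sigma tau, cancel tau sigma &
        forall i j : 'I_#|V|, (i <= j)%N -> leV (sigma i) (sigma j)].
Proof.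
move=> tot tr; pose s := sort leV (enum V).
have ss : size s = #|V| by rewrite size_sort -cardE.
have su : uniq s by rewrite sort_uniq enum_uniq.
have ms v : v \in s by rewrite mem_sort mem_enum.
have lt v : (index v s < #|V|)%N by rewrite -ss index_mem.
pose sigma (i : 'I_#|V|) := nth (enum_val i) s i.
exists sigma, (fun v => Ordinal (lt v)); split.
- by move=> i; apply: val_inj; rewrite /= index_uniq ?ss.
- by move=> v; rewrite /sigma /= nth_index.
- move=> i j le_ij; rewrite /sigma (set_nth_default (enum_val j)) ?ss //.
  apply: sorted_leq_nth => //; rewrite ?inE ?ss //; last exact: sort_sorted.
  by move=> x; case/orP: (tot x x).
Qed.

(** Potentials on a rooted tree: sum the edge labels along the path to the root.
    Iterating [par] as many times as there are vertices reaches the root from anywhere. *)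
Lemma tree_sum (V : finType) (R : zmodType) (rank : V -> nat) (par : V -> V)
    (T : V -> R) :
  (forall v, (rank v < #|V|)%N) ->
  (forall v, rank v = 0%N -> par v = v) ->
  (forall v, (0 < rank v)%N -> (rank (par v) < rank v)%N) ->
  exists b : V -> R, forall v,
    b v = if rank v == 0%N then 0 else b (par v) + T v.
Proof.
move=> rk_lt par0 par_lt.
(* Cutting the labels at roots makes the sum insensitive to extra iterations. *)
pose T' v := if rank v == 0%N then 0 else T v.
have par_le v : (rank (par v) <= (rank v).-1)%N.
  have [r0|rpos] := posnP (rank v); first by rewrite par0 // r0.
  by rewrite -ltnS prednK // par_lt.
have rk_iter i v : (rank (iter i par v) <= rank v - i)%N.
  elim: i => [|i IH] /=; first by rewrite subn0.
  by rewrite subnS (leq_trans (par_le _)) // -!subn1 leq_sub2r.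
exists (fun v => \sum_(i < #|V|) T' (iter i par v)) => v.
have [r0|rpos] := eqVneq.
  rewrite big1 // => i _; have -> : iter i par v = v.
    by elim: (i : nat) => //= j ->; apply: par0.
  by rewrite /T' r0.
have T'par : T' (iter #|V| par v) = 0.
  rewrite /T' (_ : rank _ = 0%N) //; apply/eqP; rewrite -leqn0.
  by rewrite (leq_trans (rk_iter _ _)) // leqn0 subn_eq0 ltnW.
have -> : T v = T' v by rewrite /T' (negPf rpos).
case: #|V| (rk_lt v) T'par => // N _ T'par.
rewrite big_ord_recl addrC; congr (_ + _).
rewrite big_ord_recr /= -iterSr T'par addr0.
by apply: eq_bigr => i _; rewrite -iterSr.
Qed.

Definition diff_prod (V : finType) (R : comNzRingType) (a : V -> R)
    (s : seq (V * V)) : R :=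
  \prod_(e <- s) (a e.1 - a e.2).

Section Associates.

Variables (L : fieldType) (A I : L -> Prop).
Hypothesis AI : proper_pair A I.

(** x and y have the same value. *)
Definition associates (x y : L) : Prop :=
  [/\ x != 0, y != 0, A (x / y) & A (y / x)].

Lemma associates_refl x : x != 0 -> associates x x.
Proof. by move=> x0; split=> //; rewrite divff //; apply: (pair_1 AI). Qed.

Lemma associates_sym x y : associates x y -> associates y x.
Proof. by case. Qed.

Lemma pair_div_trans x y z : y != 0 -> A (x / y) -> A (y / z) -> A (x / z).
Proof.
move=> y0 xy yz; have -> : x / z = (x / y) * (y / z) by rewrite mulrA divfK.
exact: (pairM AI).
Qed.

Lemma associates_trans x y z : associates x y -> associates y z -> associates x z.
Proof.
case=> x0 y0 xy yx [_ z0 yz zy]; split=> //.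
  exact: pair_div_trans y0 xy yz.
exact: pair_div_trans y0 zy yx.
Qed.

Lemma associatesM x y x' y' :
  associates x y -> associates x' y' -> associates (x * x') (y * y').
Proof.
case=> x0 y0 xy yx [x0' y0' xy' yx']; split; rewrite ?mulf_neq0 //.
  by rewrite -mulf_div; apply: (pairM AI).
by rewrite -mulf_div; apply: (pairM AI).
Qed.

Lemma associatesN x y : associates x y -> associates (- x) y.
Proof.
case=> x0 y0 xy yx; split; rewrite ?oppr_eq0 //.
  rewrite mulNr -sub0r; apply: (pairB AI) => //.
  exact/(pair_sub AI)/(pairI0 AI).
rewrite invrN mulrN -sub0r; apply: (pairB AI) => //.
exact/(pair_sub AI)/(pairI0 AI).
Qed.

(** The strong triangle inequality is an equality as soon as x + y is known not
    to have larger value than y. *)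
Lemma associatesD x y : y != 0 -> x + y != 0 -> A (x / y) -> A (y / (x + y)) ->
  associates (x + y) y.
Proof.
move=> y0 xy0 xy yxy; split=> //.
by rewrite mulrDl divff //; apply: (pairD AI) => //; apply: (pair_1 AI).
Qed.

End Associates.

Lemma mlead_UD (R : nzRingType) (n : nat) (i j : 'I_n) (p : {mpoly R[n]}) :
  mlead p = U_(j)%MM -> i != j ->
  mlead ('X_i + p) = if (i < j)%N then U_(i)%MM else U_(j)%MM.
Proof.
have ltU (i' j' : 'I_n) : (i' < j')%N -> (U_(j')%MM < U_(i')%MM)%O.
  move=> lt; apply/ltmcP; first by rewrite !mdeg1.
  exists i' => [k lt_ki|]; rewrite !mnm1E ?eqxx.
    have -> : (i' == k) = false by apply/negbTE; rewrite neq_ltn lt_ki orbT.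
    have -> // : (j' == k) = false.
    by apply/negbTE; rewrite neq_ltn (ltn_trans lt_ki lt) orbT.
  by rewrite (_ : (j' == i') = false) //; apply/negbTE; rewrite neq_ltn lt orbT.
move=> pj; rewrite neq_ltn => /orP[] lt.
  by rewrite lt mleadDl mleadXm // pj ltU.
by rewrite ltnNge ltnW //= mleadDr // mleadXm pj ltU.
Qed.

Section UltrametricTree.

Variables (L : fieldType) (A I : L -> Prop).
Hypothesis AI : proper_pair A I.
Variables (V : finType) (a : V -> L).
Hypothesis a_inj : injective a.

Let d (v w : V) : L := if v == w then 1 else a v - a w.

Hypothesis d_total : forall v w v' w',
  A (d v w / d v' w') \/ A (d v' w' / d v w).

Let d_neq0 v w : d v w != 0.
Proof.
rewrite /d; case: (eqVneq v w) => [_|vw]; first by rewrite oner_eq0.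
by rewrite subr_eq0 (inj_eq a_inj).
Qed.

Let dE v w : v != w -> d v w = a v - a w.
Proof. by rewrite /d => /negbTE->. Qed.

Let rank (v : V) : nat := enum_rank v.

Let nearest_exists v : exists w,
  if rank v == 0%N then w = v else
  (rank w < rank v)%N /\
  forall w', (rank w' < rank v)%N -> A (d v w / d v w').
Proof.
have [_|rpos] := eqVneq; first by exists v.
have [w0 w0P] : exists w0, (rank w0 < rank v)%N.
  have lt : (0 < #|V|)%N by apply: leq_ltn_trans (ltn_ord (enum_rank v)).
  exists (enum_val (Ordinal lt)).
  by rewrite /rank enum_valK lt0n.
pose s := [seq w <- enum V | (rank w < rank v)%N].
have [||w ws wmax] := @seq_max V (fun w w' => A (d v w' / d v w)) w0 s.
- by move=> w w'; case: (d_total v w v w'); [right|left].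
- by move=> x y z xy yz; apply: (pair_div_trans AI (d_neq0 _ _) yz xy).
exists w; split.
  by move: ws; rewrite inE mem_filter => /predU1P[->//|/andP[]].
move=> w' w'v; apply: wmax; rewrite inE mem_filter w'v mem_enum orbT //.
Qed.

(** The tree of an ultrametric, rebuilt over another field.  Each v is joined to
    the earlier point [par v] nearest to it, with u_v = a_v - a_(par v), and b
    satisfies b_v = b_(par v) + T_v with the variables T_v sorted as the values of
    the u_v.  For w before v,
      a_v - a_w = u_v + (a_(par v) - a_w)  and  b_v - b_w = T_v + (b_(par v) - b_w).
    By induction the second summands correspond to a common earlier edge k.  The
    larger of T_v and T_k leads on the right; on the left the value is that of
    the same edge, even if u_v and u_k have equal values, because a_v - a_w divides
    u_v by the choice of [par v]. *)
Lemma ultrametric_leading_terms (F : fieldType) :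
  exists (b : V -> {mpoly F[#|V|]}) (theta : 'I_#|V| -> L),
  forall v w, v != w ->
    b v - b w != 0 /\
    associates A (a v - a w) (mmap1 theta (mlead (b v - b w))).
Proof.
have [par parP] := choice nearest_exists.
pose u v := d v (par v).
have par0 v : rank v = 0%N -> par v = v.
  by move=> r0; have := parP v; rewrite r0.
have par_lt v : (0 < rank v)%N -> (rank (par v) < rank v)%N.
  by rewrite lt0n => /negPf r0; have := parP v; rewrite r0 => -[].
have par_max v w : (rank w < rank v)%N -> A (u v / d v w).
  move=> wv; have := parP v; have [r0|_ [_]] := eqVneq; last exact.
  by rewrite r0 in wv.
pose leV : rel V := fun v w => `[< A (u w / u v) >].
have [||sigma [tau [sigmaK tauK sigma_le]]] := @sorted_enumeration V leV.
- by move=> v w; apply/orP; case: (d_total w (par w) v (par v)) => h;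
    [left|right]; apply/asboolP.
- move=> v w x /asboolP wv /asboolP xw; apply/asboolP.
  exact: (pair_div_trans AI (d_neq0 _ _) xw wv).
have u_le v w : (tau v <= tau w)%N -> A (u w / u v).
  by move/sigma_le/asboolP; rewrite !tauK.
have [|||b bE] := @tree_sum V {mpoly F[#|V|]} rank par (fun v => 'X_(tau v)).
- by move=> v; apply: ltn_ord.
- exact: par0.
- exact: par_lt.
exists b, (u \o sigma).
have rank_inj : injective rank.
  by move=> v w /val_inj /enum_rank_inj.
suff main n v w : (rank v < n)%N -> (rank w < n)%N -> v != w ->
    exists k, [/\ (rank k < n)%N, mlead (b v - b w) = U_(tau k)%MM &
                  associates A (a v - a w) (u k)].
  move=> v w vw; have [||k [_ lead as_vw]] := main #|V| v w _ _ vw.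
  - exact: ltn_ord.
  - exact: ltn_ord.
  split; last by rewrite lead mmap1U /= tauK.
  apply/eqP => b0; have := congr1 mdeg lead.
  by rewrite b0 mlead0 mdeg0 mdeg1.
elim: n v w => // n IH.
suff lt_main v w : (rank v <= n)%N -> (rank w < rank v)%N ->
    exists k, [/\ (rank k <= n)%N, mlead (b v - b w) = U_(tau k)%MM &
                  associates A (a v - a w) (u k)].
  move=> v w; rewrite !ltnS => vn wn vw.
  case: (ltngtP (rank w) (rank v)) => [lt|lt|/rank_inj E]; first exact: lt_main.
    have [k [kn lead as_wv]] := lt_main w v wn lt.
    exists k; split=> //; first by rewrite -mleadN opprB.
    by rewrite -opprB; apply: (associatesN AI).
  by rewrite E eqxx in vw.
rewrite leq_eqVlt => /predU1P[vn|vn] wv; last first.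
  have [|k [kn lead as_k]] := IH v w vn (ltn_trans wv vn).
    by apply: contraTneq wv => ->; rewrite ltnn.
  by exists k; split=> //; apply: ltnW.
have rpos : (0 < rank v)%N by apply: leq_ltn_trans wv.
have par_v := par_lt v rpos.
have bv : b v = b (par v) + 'X_(tau v) by rewrite bE -[_ == _]negbK -lt0n rpos.
have vpar : v != par v by apply: contraTneq par_v => <-; rewrite ltnn.
have vw : v != w by apply: contraTneq wv => <-; rewrite ltnn.
have uv : u v = a v - a (par v) by rewrite /u dE.
have [->|par_w] := eqVneq w (par v).
  exists v; split; first by rewrite vn.
  - by rewrite bv addrC addKr mleadXm.
  - by rewrite -uv; apply: (associates_refl AI); apply: d_neq0.
have [|||k [kn lead as_k]] := IH (par v) w.
- by rewrite -vn.
- by rewrite -vn.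
- by rewrite eq_sym.
have k_v : tau v != tau k.
  by rewrite (can_eq tauK); apply: contraTneq kn => <-; rewrite vn ltnn.
have par_w' : par v != w by rewrite eq_sym.
have sum_vw : a v - a w = u v + (a (par v) - a w) by rewrite uv; ring.
have sum_vw0 : a v - a w != 0 by rewrite -dE ?d_neq0.
have b_vw : b v - b w = 'X_(tau v) + (b (par v) - b w) by rewrite bv; ring.
have u_vw : A (u v / (a v - a w)) by rewrite -dE //; apply: par_max.
rewrite b_vw (mlead_UD lead k_v).
have [_ uk0 kl kr] := as_k.
have par_w0 : a (par v) - a w != 0 by rewrite -dE ?d_neq0.
case: (ltnP (tau v) (tau k)) => [/ltnW/u_le le_vk|/u_le le_kv].
- exists v; split=> //; first by rewrite vn.
  rewrite sum_vw addrC; apply: (associatesD AI).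
  + exact: d_neq0.
  + by rewrite addrC -sum_vw.
  + exact: (pair_div_trans AI uk0 kl le_vk).
  + by rewrite addrC -sum_vw.
- exists k; split=> //; first exact: ltnW.
  apply: (associates_trans AI) as_k; rewrite sum_vw; apply: (associatesD AI) => //.
  + by rewrite -sum_vw.
  + exact: (pair_div_trans AI uk0 le_kv kr).
  + rewrite -sum_vw (_ : a (par v) - a w = (a v - a w) - u v); last first.
      by rewrite sum_vw [u v + _]addrC addrK.
    rewrite mulrBl divff //; apply: (pairB AI) => //; exact: (pair_1 AI).
Qed.

End UltrametricTree.

(** Through [theta], the leading monomial of a monomial in the new products gives
    back the value of the same monomial in the old ones.  The values are
    distinct, hence so are the leading monomials. *)
Theorem diff_prod_independence_transfer (F F' L : fieldType)
    (iota : {rmorphism F -> L}) (V : finType) (a : V -> L) (D : nat)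
    (E : 'I_D -> seq (V * V)) :
  injective a -> (forall j e, e \in E j -> e.1 != e.2) ->
  (forall P : {mpoly F[D]},
     mmap iota (fun j => diff_prod a (E j)) P = 0 -> P = 0) ->
  exists b : V -> {mpoly F'[#|V|]},
    (forall v w, v != w -> b v - b w != 0) /\
    forall P : {mpoly F'[D]}, P != 0 ->
      mmap (@mpolyC _ F') (fun j => diff_prod b (E j)) P != 0.
Proof.
move=> a_inj E_neq f_indep; set f := (fun j => diff_prod a (E j)) in f_indep *.
pose d v w := if v == w then 1 else a v - a w.
(* The value 1 of d on the diagonal makes every ratio meaningful. *)
pose s := [seq d p.1.1 p.1.2 / d p.2.1 p.2.2 | p <- enum {: (V * V) * (V * V)}].
have [A [I [AI sI sA As]]] :=
  valuation_extension s (bounded_fraction_proper f_indep).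
have d_total v w v' w' : A (d v w / d v' w') \/ A (d v' w' / d v w).
  rewrite -[d v' w' / d v w]invf_div; apply: As.
  by apply/mapP; exists ((v, w), (v', w')); rewrite ?mem_enum.
have [b [theta btheta]] := ultrametric_leading_terms AI a_inj d_total F'.
exists b; split=> [v w /btheta[] //|P P0].
pose g j := diff_prod b (E j).
pose dominant_term (p : {mpoly F'[#|V|]}) (x : L) :=
  p != 0 /\ associates A x (mmap1 theta (mlead p)).
have dom1 : dominant_term 1 1.
  split; first exact: oner_neq0.
  by rewrite mlead1 mmap11; apply: (associates_refl AI); apply: oner_neq0.
have domM p q x y :
    dominant_term p x -> dominant_term q y -> dominant_term (p * q) (x * y).
  move=> [p0 px] [q0 qy]; split; first by rewrite mulf_neq0.
  rewrite mleadM // commr_mmap1_M; last by move=> i z; apply: mulrC.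
  exact: (associatesM AI).
have dom_gf j : dominant_term (g j) (f j).
  rewrite /g /f /diff_prod; elim: (E j) (E_neq j) => [|e t IH] e_neq.
    by rewrite !big_nil.
  rewrite !big_cons; apply: domM; first by apply: btheta; apply: e_neq; apply: mem_head.
  by apply: IH => e' e't; apply: e_neq; rewrite inE e't orbT.
have dom_mon m : dominant_term (mmap1 g m) (mmap1 f m).
  rewrite /mmap1; elim/big_rec2: _ => // j p x _ px; apply: (domM) => //.
  elim: (m j) => // k IH; rewrite !exprS; exact: domM.
have mlead_inj : injective (fun m => mlead (mmap1 g m)).
  have lt_absurd m m' : (m < m')%O -> mlead (mmap1 g m) = mlead (mmap1 g m') -> False.
    move=> lt_mm' eq_lead; have [_ as_m] := dom_mon m; have [_ as_m'] := dom_mon m'.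
    rewrite eq_lead in as_m.
    have [_ m'0 _ m'm] := associates_trans AI as_m (associates_sym as_m').
    have := sI _ (monomial_bounded_fraction iota m'0 lt_mm').
    move/(pairIM AI m'm).
    have [m0 _ _ _] := as_m.
    by rewrite mulrA divfK // divff //; apply: (pair_proper AI).
  move=> m m' eq_lead; case: (ltgtP m m') => // lt_mm'.
    by case: (lt_absurd _ _ lt_mm' eq_lead).
  by case: (lt_absurd _ _ lt_mm' (esym eq_lead)).
have lead_term m : m \in msupp P ->
    mlead ((P@_m)%:MP * mmap1 g m) = mlead (mmap1 g m).
  by rewrite mcoeff_msupp => Pm; rewrite mul_mpolyC mleadZ.
apply: sum_distinct_mlead_neq0.
- by rewrite msupp_eq0.
- move=> m; rewrite mcoeff_msupp => Pm; rewrite mul_mpolyC scaler_eq0 negb_or Pm.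
  by case: (dom_mon m).
- rewrite (_ : map _ _ = [seq mlead (mmap1 g m) | m <- msupp P]).
    by rewrite map_inj_uniq ?msupp_uniq.
  by apply/eq_in_map => m /lead_term.
Qed.

(** * Polynomials over algebraically closed fields *)

Lemma mmap_ext (R S : nzRingType) (n : nat) (f f' : R -> S) (h h' : 'I_n -> S)
    (p : {mpoly R[n]}) :
  f =1 f' -> h =1 h' -> mmap f h p = mmap f' h' p.
Proof.
by move=> ff' hh'; apply: eq_bigr => m _; rewrite ff' (mmap1_eq _ hh').
Qed.

Lemma rmorph_mmap (R : nzRingType) (S T : comNzRingType) (n : nat)
    (phi : {rmorphism S -> T}) (f : R -> S) (h : 'I_n -> S) (p : {mpoly R[n]}) :
  phi (mmap f h p) = mmap (phi \o f) (phi \o h) p.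
Proof.
rewrite rmorph_sum; apply: eq_bigr => m _; rewrite rmorphM rmorph_prod.
by congr (_ * _); apply: eq_bigr => i _; rewrite rmorphXn.
Qed.

Lemma meval_mmap (R S : comNzRingType) (n k : nat) (f : R -> S)
    (h : 'I_n -> {mpoly S[k]}) (v : 'I_k -> S) (p : {mpoly R[n]}) :
  (mmap (@mpolyC k S \o f) h p).@[v] = mmap f (fun i => (h i).@[v]) p.
Proof. by rewrite rmorph_mmap; apply: mmap_ext => // c; rewrite /= mevalC. Qed.

Lemma meval_map_mpoly (R S : comNzRingType) (n : nat) (f : R -> S)
    (v : 'I_n -> S) (p : {mpoly R[n]}) :
  (map_mpoly f p).@[v] = mmap f v p.
Proof. by rewrite meval_mmap; apply: mmap_ext => // i; rewrite mevalXU. Qed.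

(** Induction on the number of variables, an algebraically closed field being
    infinite. *)
Lemma mpoly_nonzero_point (L : closedFieldType) (n : nat) (P : {mpoly L[n]}) :
  P != 0 -> exists v, P.@[v] != 0.
Proof.
elim: n P => [|n IH] P P0.
  exists (fun _ => 0); move: P0; rewrite [P]nvar0_mpolyC mevalC.
  by rewrite mpolyC_eq0.
pose trunc (m : 'X_{1..n.+1}) := [multinom m (widen_ord (leqnSn n) i) | i < n].
have muni0 : muni P != 0.
  move: P0; rewrite -msupp_eq0; case Pm: (msupp P) => [//|m0 ms] _.
  have m0P : m0 \in msupp P by rewrite Pm mem_head.
  apply: contraTneq m0P => P0; rewrite mcoeff_msupp negbK.
  have := congr1 (fun q : {poly {mpoly L[n]}} => q`_(m0 ord_max)@_(trunc m0)) P0.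
  rewrite muniE coef_sum coef0 mcoeff0 raddf_sum /=.
  rewrite (bigD1_seq m0) ?msupp_uniq ?Pm ?mem_head //= big1 => [|m ne_m].
    by rewrite coefZ coefXn eqxx mulr1 mcoeffZ mcoeffX eqxx mulr1 addr0 => ->.
  rewrite coefZ coefXn; have [Emax|_] := eqVneq; last by rewrite mulr0 mcoeff0.
  rewrite mulr1 mcoeffZ mcoeffX; have [Etr|_] := eqVneq; last by rewrite mulr0.
  case/eqP: ne_m; apply/mnmP => i; have [lt_in|ge_in] := ltnP i n.
    have := congr1 (fun m' : 'X_{1..n} => m' (Ordinal lt_in)) Etr.
    by rewrite /= !mnmE (_ : widen_ord _ _ = i) //; apply: val_inj.
  suff -> : i = ord_max by [].
  by apply/val_inj/anti_leq; rewrite ge_in andbT -ltnS ltn_ord.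
have [v /IH] : exists k, (muni P)`_k != 0.
  by exists (size (muni P)).-1; rewrite -lead_coefE lead_coef_eq0.
move=> [w cw].
have /closed_nonrootP [t rt] : map_poly (meval w) (muni P) != 0.
  by apply: contraNneq cw => /(congr1 (coefp v)); rewrite /= coef_map coef0 => ->.
exists (fun i => oapp w t (unlift ord_max i)).
apply: contraNneq rt => E; apply/rootP; rewrite -[RHS]E mevalE muniE.
rewrite raddf_sum /= horner_sum; apply: eq_bigr => m _.
rewrite map_polyZ map_polyXn hornerZ hornerXn /= mevalZ mevalX -mulrA.
congr (_ * _); rewrite big_ord_recr /= unlift_none; congr (_ * _).
apply: eq_bigr => i _; rewrite mnmE; congr (_ ^+ _).
have -> : widen_ord (leqnSn n) i = lift ord_max i by apply: val_inj; exact: (esym (lift_max i)).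
by rewrite liftK.
Qed.

Lemma poly_ext_closed (L : closedFieldType) (p q : {poly L}) :
  (forall t, p.[t] = q.[t]) -> p = q.
Proof.
move=> pq; apply/eqP; rewrite -subr_eq0; apply/negPn/negP => /closed_nonrootP.
by case=> t /rootP[]; rewrite hornerD hornerN pq subrr.
Qed.

Lemma dvdp_mul_gcd (L : fieldType) (I : finType) (g : I -> {poly L}) (f q : {poly L}) :
  (forall i, q %| f * g i) -> q %| f * \big[@gcdp L/0]_i g i.
Proof.
move=> qfg; elim/big_rec: _ => [|i h _ IH]; first by rewrite mulr0 dvdp0.
by rewrite (eqp_dvdr _ (mulp_gcdr _ _ _)) dvdp_gcd qfg.
Qed.

Lemma gcd_dvdp (L : fieldType) (I : finType) (g : I -> {poly L}) (i : I) :
  \big[@gcdp L/0]_i g i %| g i.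
Proof.
have : i \in index_enum I by rewrite mem_index_enum.
elim: (index_enum I) => // j s IH; rewrite inE big_cons.
case/predU1P=> [->|/IH]; first exact: dvdp_gcdl.
by apply: dvdp_trans; apply: dvdp_gcdr.
Qed.

(** Two proportional vectors of polynomials: if g has no common zero, its entries
    have gcd 1, so g_i0, which divides every f_i0 g_i, divides f_i0. *)
Lemma common_quotient (L : closedFieldType) (I : finType) (f g : I -> {poly L}) :
  (forall t, exists i, (g i).[t] != 0) ->
  (forall i j, f i * g j = f j * g i) ->
  exists e, forall i, f i = e * g i.
Proof.
move=> g_nz fg; have [i0 gi0t] := g_nz 0.
have gi0 : g i0 != 0 by apply: contraNneq gi0t => ->; rewrite horner0.
have gcd1 : size (\big[@gcdp L/0]_i g i) == 1%N.
  apply/negPn/negP => /closed_rootP[t rt].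
  have [i /negP[]] := g_nz t; apply/eqP/rootP.
  by move: rt; rewrite -!dvdp_XsubCl => /dvdp_trans; apply; apply: gcd_dvdp.
have dvd_fg : g i0 %| f i0.
  have : g i0 %| f i0 * \big[@gcdp L/0]_i g i.
    by apply: dvdp_mul_gcd => i; rewrite fg dvdp_mull.
  have /size_poly1P [c c0 ->] := gcd1.
  by rewrite mulrC mul_polyC dvdpZr.
exists (f i0 %/ g i0) => i; apply: (mulIf gi0).
by rewrite fg mulrAC divpK.
Qed.

(** * Cox coordinates *)

(** The Cox coordinates of Bl_(P^s)(P^r): X_0, ..., X_s, then E (the equation of
    the exceptional divisor), then the Y_j with x_(s+1+j) = E Y_j. *)
Definition cox_index (r s : nat) : finType := ('I_s.+1 + option 'I_(r - s))%type.

Notation Ec := (inr None : cox_index _ _).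
Notation Xc j := (inl j : cox_index _ _).
Notation Yc j := (inr (Some j) : cox_index _ _).

Definition cox_degree (r s d k : nat) (q : cox_index r s) : nat :=
  match q with inl _ => d | inr None => k | inr (Some _) => d - k end.

(** The grading of the Cox ring: rescaling the coordinates of P^(r-s-1) by mu and
    those of P^r by lambda mu multiplies X by lambda mu, E by lambda, Y by mu. *)
Definition x_scaled (r s : nat) (q : cox_index r s) : bool :=
  if q is inr (Some _) then false else true.
Definition y_scaled (r s : nat) (q : cox_index r s) : bool :=
  if q is inr None then false else true.

Definition cox_value (R : comNzRingType) (r s d k n : nat)
    (lam mu : 'I_n -> R) (c : cox_index r s -> R) (t : 'I_n -> R)
    (rho : cox_index r s -> 'I_d -> R) (i : 'I_n) (q : cox_index r s) : R :=
  lam i ^+ x_scaled q * mu i ^+ y_scaled q *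
  (c q * \prod_(l < d | (l < cox_degree d k q)%N) (t i - rho q l)).

Definition cox_var (r s d n : nat) : finType :=
  (('I_n + ('I_n + 'I_n)) + (cox_index r s + cox_index r s * 'I_d))%type.
(** [None] is the point 0 of the affine line, so that the parameters lambda_i, mu_i
    and c_q become differences of points as well. *)
Definition cox_point (r s d n : nat) : finType := option (cox_var r s d n).

Definition pt_time (r s d n : nat) (i : 'I_n) : cox_point r s d n :=
  Some (inl (inl i)).
Definition pt_lam (r s d n : nat) (i : 'I_n) : cox_point r s d n :=
  Some (inl (inr (inl i))).
Definition pt_mu (r s d n : nat) (i : 'I_n) : cox_point r s d n :=
  Some (inl (inr (inr i))).
Definition pt_coef (r s d n : nat) (q : cox_index r s) : cox_point r s d n :=
  Some (inr (inl q)).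
Definition pt_root (r s d n : nat) (q : cox_index r s) (l : 'I_d) :
    cox_point r s d n :=
  Some (inr (inr (q, l))).

Definition cox_edges (r s d k n : nat) (iq : 'I_n * cox_index r s) :
    seq (cox_point r s d n * cox_point r s d n) :=
  nseq (x_scaled iq.2) (pt_lam r s d iq.1, None) ++
  nseq (y_scaled iq.2) (pt_mu r s d iq.1, None) ++
  (pt_coef d n iq.2, None) ::
  [seq (pt_time r s d iq.1, pt_root n iq.2 l) |
     l : 'I_d <- index_enum 'I_d & (l < cox_degree d k iq.2)%N].

Lemma cox_edges_neq (r s d k n : nat) (iq : 'I_n * cox_index r s) e :
  e \in cox_edges d k iq -> e.1 != e.2.
Proof.
rewrite !mem_cat inE => /or4P[/nseqP[-> _]|/nseqP[-> _]|/eqP->|] //.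
by case/mapP=> l _ ->.
Qed.

Lemma diff_prod_cox_edges (R : comNzRingType) (r s d k n : nat)
    (a : cox_point r s d n -> R) (i : 'I_n) (q : cox_index r s) :
  diff_prod a (cox_edges d k (i, q)) =
  cox_value k (fun i => a (pt_lam r s d i) - a None)
    (fun i => a (pt_mu r s d i) - a None) (fun q => a (pt_coef d n q) - a None)
    (fun i => a (pt_time r s d i)) (fun q l => a (pt_root n q l)) i q.
Proof.
rewrite /diff_prod /cox_edges /cox_value !big_cat big_cons big_map big_filter /=.
by rewrite !big_nseq -!Monoid.iteropE !mulrA.
Qed.

Definition base_idx (r s : nat) (j : 'I_s.+1) : 'I_r.+1 := inord j.

Definition proj_coord (R : comNzRingType) (r s : nat) (w : cox_index r s -> R)
    (j : 'I_r.+1) : R :=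
  if insub (j : nat) is Some j0 then w (Xc j0)
  else if insub (j - s.+1)%N is Some j1 then w Ec * w (Yc j1) else 0.

Lemma val_base_idx (r s : nat) (j : 'I_s.+1) : (s <= r)%N -> base_idx r j = j :> nat.
Proof. by move=> sr; rewrite inordK // (leq_trans (ltn_ord j)). Qed.

Lemma val_normal_idx (r s : nat) (j : 'I_(r - s)) :
  normal_idx j = (s.+1 + j)%N :> nat.
Proof. by rewrite inordK // addSn ltnS -ltn_subRL. Qed.

Lemma proj_idxP (r s : nat) (j : 'I_r.+1) : (s <= r)%N ->
  (exists j0, j = base_idx r (j0 : 'I_s.+1)) \/
  (exists j1 : 'I_(r - s), j = normal_idx j1).
Proof.
move=> sr; have [js|sj] := ltnP j s.+1.
  by left; exists (Ordinal js); apply: val_inj; rewrite /= val_base_idx.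
have lt : (j - s.+1 < r - s)%N by have := ltn_ord j; lia.
by right; exists (Ordinal lt); apply: val_inj; rewrite /= val_normal_idx /= subnKC.
Qed.

Section ProjCoord.

Variables (R : comNzRingType) (r s : nat) (w : cox_index r s -> R).
Hypothesis sr : (s <= r)%N.

Lemma proj_coord_base (j : 'I_s.+1) : proj_coord w (base_idx r j) = w (Xc j).
Proof.
rewrite /proj_coord; case: insubP => [j0 _|]; last first.
  by rewrite val_base_idx // ltn_ord.
by rewrite val_base_idx // => /val_inj ->.
Qed.

Lemma proj_coord_normal (j : 'I_(r - s)) :
  proj_coord w (normal_idx j) = w Ec * w (Yc j).
Proof.
rewrite /proj_coord insubF; last by rewrite val_normal_idx ltnNge leq_addr.
by rewrite val_normal_idx addKn valK.
Qed.

End ProjCoord.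

Lemma rmorph_proj_coord (R S : comNzRingType) (phi : {rmorphism R -> S}) (r s : nat)
    (w : cox_index r s -> R) (j : 'I_r.+1) :
  phi (proj_coord w j) = proj_coord (phi \o w) j.
Proof.
rewrite /proj_coord; case: insub => //; case: insub => [j1|]; last exact: rmorph0.
exact: rmorphM.
Qed.

Lemma proj_coord_ext (R : comNzRingType) (r s : nat) (w w' : cox_index r s -> R) :
  w =1 w' -> proj_coord w =1 proj_coord w'.
Proof. by move=> ww' j; rewrite /proj_coord; do !case: insub => [?|]; rewrite ?ww'. Qed.

Lemma proj_coord_scaled (R : comNzRingType) (r s : nat) (lam mu : R)
    (w : cox_index r s -> R) (j : 'I_r.+1) :
  proj_coord (fun q => lam ^+ x_scaled q * mu ^+ y_scaled q * w q) j =
  lam * mu * proj_coord w j.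
Proof.
rewrite /proj_coord; case: insub => [j0|]; first by rewrite !expr1.
case: insub => [j1|]; rewrite /= ?mulr0 // !expr1 !expr0; ring.
Qed.

Section CoxCurve.

Variables (L : fieldType) (r s d k n : nat).
Hypotheses (hrs : (s.+2 <= r)%N) (hdk : (k < d)%N).
Variables (c : cox_index r s -> L) (rho : cox_index r s -> 'I_d -> L).

Let sr : (s <= r)%N. Proof. by apply: leq_trans hrs; rewrite leqW. Qed.

Definition cox_form (q : cox_index r s) : {mpoly L[2]} :=
  c q *: \prod_(l < d | (l < cox_degree d k q)%N) ('X_1 - rho q l *: 'X_0).

Lemma cox_form_eval (q : cox_index r s) (u : 'I_2 -> L) :
  (cox_form q).@[u] =
  c q * \prod_(l < d | (l < cox_degree d k q)%N) (u 1 - rho q l * u 0).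
Proof.
rewrite mevalZ rmorph_prod; congr (_ * _); apply: eq_bigr => l _.
by rewrite /= mevalB mevalZ !mevalXU.
Qed.

Lemma cox_form_homog (q : cox_index r s) :
  cox_form q \is (cox_degree d k q).-homog.
Proof.
rewrite /cox_form; set m := cox_degree d k q.
have le_md : (m <= d)%N.
  by rewrite /m; case: q @m => [?|[?|]] //=; rewrite ?leq_subr // ltnW.
have cm : (\sum_(l < d | (l < m)%N) 1 = m)%N.
  by rewrite -(big_ord_widen d (fun=> 1%N) le_md) sum1_card card_ord.
suff homog_prod : \prod_(l < d | (l < m)%N) ('X_1 - rho q l *: 'X_0 : {mpoly L[2]})
    \is (\sum_(l < d | (l < m)%N) 1).-homog by rewrite cm in homog_prod; apply: dhomogZ.
elim/big_rec2: _ => [|l e p _ homog_p]; first exact: dhomog1.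
apply: dhomogM homog_p.
by apply: rpredB; rewrite ?rpredZ // dhomogX /= mdeg1.
Qed.

Lemma cox_form_common_zero (q q' : cox_index r s) (u : 'I_2 -> L) :
  (forall q, c q != 0) -> (forall q q' l l', q != q' -> rho q l != rho q' l') ->
  q != q' -> (cox_form q).@[u] = 0 -> (cox_form q').@[u] = 0 ->
  u 0 = 0 /\ u 1 = 0.
Proof.
move=> c0 rho_neq qq'.
have zero q1 : (cox_form q1).@[u] = 0 -> exists l, u 1 = rho q1 l * u 0.
  rewrite cox_form_eval => /eqP; rewrite mulf_eq0 (negPf (c0 _)) /=.
  by case/prodf_eq0 => l _; rewrite subr_eq0 => /eqP; exists l.
move=> /zero[l El] /zero[l' El'].
have u0 : u 0 = 0.
  apply/eqP; have := rho_neq q q' l l' qq'; rewrite -subr_eq0.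
  apply: contraNT => u0; rewrite -(mulIr_eq0 _ (mulIf u0)) mulrBl -El -El' subrr.
  by [].
by rewrite El u0 mulr0.
Qed.

(** As the roots of different forms are distinct, at most one Cox coordinate
    vanishes at any point of P^1, so that neither (X, E Y) nor Y vanishes.  This
    uses that there are at least two coordinates Y_j, and one X_j. *)
Lemma cox_curve_in_image (lam mu t : 'I_n -> L) :
  (forall q, c q != 0) -> (forall q q' l l', q != q' -> rho q l != rho q' l') ->
  injective t -> (forall i, lam i != 0) -> (forall i, mu i != 0) ->
  in_ev_image d k (\matrix_(i < n) \row_j proj_coord (cox_value k lam mu c t rho i) j)
    (\matrix_(i < n) \row_j cox_value k lam mu c t rho i (Yc j)).
Proof.
move=> c0 rho_neq t_inj lam0 mu0.
pose z : 'M[L]_(n, 2) := \matrix_(i, e) (if e == 0 then 1 else t i).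
have valE i q : cox_value k lam mu c t rho i q =
    lam i ^+ x_scaled q * mu i ^+ y_scaled q * (cox_form q).@[row i z 0].
  rewrite cox_form_eval; congr (_ * (_ * _)); apply: eq_bigr => l _.
  by rewrite !mxE /= mulr1.
have jpos : (0 < r - s)%N by rewrite subn_gt0 (leq_trans _ hrs).
have jpos1 : (1 < r - s)%N by rewrite ltn_subRL addn1.
have zero := cox_form_common_zero c0 rho_neq.
have u_neq (u : 'rV[L]_2) : u != 0 -> ~ (u 0 0 = 0 /\ u 0 1 = 0).
  move=> u0 [u00 u01]; case/eqP: u0; apply/rowP => e; rewrite mxE.
  by have [->|] := eqVneq e 0; last by case: e => [[|[|?]] lt] // _; rewrite -u01;
    congr (u 0 _); apply: val_inj.
exists (proj_coord cox_form), (fun j => cox_form (Yc j)), z; split.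
- split=> [j|j|u u0]; last split.
  + have [[j0 ->]|[j1 ->]] := proj_idxP j sr.
      by rewrite proj_coord_base //; apply: cox_form_homog.
    rewrite proj_coord_normal // -[d in d.-homog](subnKC (ltnW hdk)).
    exact: dhomogM (cox_form_homog _) (cox_form_homog _).
  + exact: (cox_form_homog (Yc j)).
  + apply/eqP => /rowP x0; apply: (u_neq u u0).
    have := x0 (base_idx r (0 : 'I_s.+1)); have := x0 (normal_idx (Ordinal jpos)).
    rewrite !mxE !(rmorph_proj_coord (meval (u 0))) proj_coord_normal proj_coord_base //.
    move=> /eqP; rewrite mulf_eq0 => /orP[] /eqP q0 X0.
      exact: zero X0 q0.
    exact: zero X0 q0.
  + apply/eqP => /rowP y0; apply: (u_neq u u0).
    have := y0 (Ordinal jpos); have := y0 (Ordinal jpos1).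
    by rewrite !mxE; apply: zero.
  + move=> i j; rewrite !mxE !(rmorph_proj_coord (meval (u 0))) !proj_coord_normal //=.
    by rewrite mulrAC.
- split=> [i|i j ij [a a0 /rowP E]].
    apply/eqP => /rowP/(_ 0)/eqP; rewrite !mxE oner_eq0 //.
  case/eqP: ij; apply: t_inj.
  have := E 0; have := E 1; rewrite !mxE /= mulr1 => -> <-.
  by rewrite mul1r.
- move=> i; split.
    exists (lam i * mu i); first by rewrite mulf_neq0.
    apply/rowP => j; rewrite !mxE (rmorph_proj_coord (meval _)).
    rewrite -proj_coord_scaled; apply: proj_coord_ext => q; exact: valE.
  exists (mu i) => //; apply/rowP => j; rewrite !mxE.
  by rewrite valE /= expr0 expr1 mul1r.
Qed.

End CoxCurve.

Definition cox_coord (n r s : nat) : finType := ('I_n * cox_index r s)%type.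

Definition cox_family (R : comNzRingType) (r s d k n : nat)
    (a : cox_point r s d n -> R) (j : 'I_#|cox_coord n r s|) : R :=
  diff_prod a (cox_edges d k (enum_val j)).

Lemma rmorph_cox_family (R S : comNzRingType) (phi : {rmorphism R -> S})
    (r s d k n : nat) (a : cox_point r s d n -> R) (j : 'I_#|cox_coord n r s|) :
  phi (cox_family k a j) = cox_family k (phi \o a) j.
Proof. by rewrite rmorph_prod; apply: eq_bigr => e _; rewrite rmorphB. Qed.

Definition generic_point (F : fieldType) (r s d n : nat) (v : cox_point r s d n) :
    {mpoly F[#|cox_var r s d n|]} :=
  oapp (fun v => 'X_(enum_rank v)) 0 v.

Lemma generic_point_inj (F : fieldType) (r s d n : nat) :
  injective (@generic_point F r s d n).
Proof.
have X_neq0 (v : cox_var r s d n) :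
    'X_(enum_rank v) <> 0 :> {mpoly F[#|cox_var r s d n|]}.
  move/(congr1 (mcoeff U_(enum_rank v)))/eqP.
  by rewrite mcoeffX eqxx mcoeff0 oner_eq0.
move=> [v|] [w|] //= => [/(congr1 (@mlead _ _))|/X_neq0|/esym/X_neq0] //.
rewrite !mleadXm => /mnmP/(_ (enum_rank w)).
by rewrite !mnm1E eqxx; case: eqP => // /enum_rank_inj ->.
Qed.

Definition cox_independent (F : fieldType) (r s d k n : nat) : Prop :=
  forall P : {mpoly F[#|cox_coord n r s|]},
    mmap (@mpolyC _ F) (cox_family k (@generic_point F r s d n)) P = 0 -> P = 0.

(** E is the ratio of x_(s+1+j) to y_j for any j with y_j nonzero. *)
Lemma blowup_pt_cox (L : fieldType) (r s : nat) (x : 'rV[L]_r.+1)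
    (y : 'rV[L]_(r - s)) : (s <= r)%N -> blowup_pt x y ->
  exists w : cox_index r s -> L,
    (forall j, x 0 j = proj_coord w j) /\ (forall j, y 0 j = w (Yc j)).
Proof.
move=> sr [_ y0 xy].
have [j0 yj0] : exists j0, y 0 j0 != 0.
  by apply/existsP; apply: contraNT y0; rewrite negb_exists => /forallP h;
     apply/eqP/rowP => j; rewrite mxE; apply/eqP; rewrite -[_ == _]negbK h.
exists (fun q => match q with
  | inl j => x 0 (base_idx r j)
  | inr None => x 0 (normal_idx j0) / y 0 j0
  | inr (Some j) => y 0 j end); split=> // j.
have [[j1 ->]|[j1 ->]] := proj_idxP j sr; first by rewrite proj_coord_base.
by rewrite proj_coord_normal // mulrAC -xy mulfK.
Qed.

Lemma tofrac_injective (R : idomainType) : injective (@tofrac R).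
Proof. by move=> x y /eqP; rewrite tofrac_eq => /eqP. Qed.

(** A multihomogeneous P, rewritten in Cox coordinates, is a polynomial P'.  If
    P' = 0, then P vanishes on the whole blow-up.  Otherwise P' is nonzero at some
    choice of products of differences, and the points can be kept distinct; this
    is a curve through n points at which P does not vanish. *)
Lemma independent_dominant (F F0 : fieldType) (L : closedFieldType)
    (iota : {rmorphism F -> L}) (r s d k n : nat) :
  (s.+2 <= r)%N -> (k < d)%N -> cox_independent F0 r s d k n ->
  ev_dominant iota r s d k n.
Proof.
move=> hrs hdk indep a b P _ P_image x y xy.
have sr : (s <= r)%N by apply: leq_trans hrs; rewrite leqW.
pose X (w : cox_coord n r s -> L) : 'M[L]_(n, r.+1) :=
  \matrix_i \row_j proj_coord (fun q => w (i, q)) j.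
pose Y (w : cox_coord n r s -> L) : 'M[L]_(n, r - s) :=
  \matrix_i \row_j w (i, Yc j).
pose w0 iq : {mpoly L[#|cox_coord n r s|]} := 'X_(enum_rank iq).
pose X0 : 'M_(n, r.+1) := \matrix_i \row_j proj_coord (fun q => w0 (i, q)) j.
pose Y0 : 'M_(n, r - s) := \matrix_i \row_j w0 (i, Yc j).
pose P' := mmap (@mpolyC _ L \o iota) (mxvec (row_mx X0 Y0) 0) P.
have P'E w : P'.@[fun j => w (enum_val j)] =
    (map_mpoly iota P).@[mxvec (row_mx (X w) (Y w)) 0].
  rewrite meval_mmap meval_map_mpoly; apply: mmap_ext => // e.
  have [i j] := mxvec_indexP e; rewrite !mxvecE !mxE.
  case: split => j'; rewrite !mxE; last by rewrite mevalXU enum_rankK.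
  rewrite (rmorph_proj_coord (meval _)); apply: proj_coord_ext => q.
  by rewrite /= mevalXU enum_rankK.
have [P'0|P'0] := eqVneq P' 0.
  have cox_xy i := blowup_pt_cox sr (xy i).
  have [w wxy] := choice cox_xy.
  have -> : x = X (fun iq => w iq.1 iq.2).
    by apply/matrixP => i j; have [/(_ j) xE _] := wxy i; move: xE; rewrite !mxE.
  have -> : y = Y (fun iq => w iq.1 iq.2).
    by apply/matrixP => i j; have [_ /(_ j) yE] := wxy i; move: yE; rewrite !mxE.
  by rewrite /vanishes_at -P'E P'0 meval0.
pose to_frac := @tofrac {mpoly F0[#|cox_var r s d n|]}.
pose iota0 : {rmorphism F0 -> {fraction {mpoly F0[#|cox_var r s d n|]}}} :=
  to_frac \o @mpolyC _ F0.
pose a0 := to_frac \o @generic_point F0 r s d n.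
have a0_inj : injective a0.
  by apply: inj_comp; [exact: tofrac_injective | exact: generic_point_inj].
have indep0 (R : {mpoly F0[#|cox_coord n r s|]}) :
    mmap iota0 (fun j => diff_prod a0 (cox_edges d k (enum_val j))) R = 0 -> R = 0.
  move=> R0; apply: indep; apply: tofrac_injective; rewrite tofrac0 -[RHS]R0 rmorph_mmap.
  by apply: mmap_ext => // j; rewrite /= rmorph_cox_family.
have [v [v_inj /(_ _ P'0) vP]] := diff_prod_independence_transfer L a0_inj
  (fun j e => @cox_edges_neq r s d k n (enum_val j) e) indep0.
(* Nonvanishing of the gaps keeps marked points and roots distinct. *)
pose gaps := \prod_(p : cox_point r s d n * cox_point r s d n | p.1 != p.2)
  (v p.1 - v p.2).
have [|pt] := @mpoly_nonzero_point L _
    (mmap (@mpolyC _ L) (cox_family k v) P' * gaps).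
  by rewrite mulf_neq0 //; apply/prodf_neq0 => p; apply: v_inj.
rewrite mevalM mulf_eq0 negb_or => /andP[P'pt gaps_pt].
pose u p := (v p).@[pt].
have u_neq p p' : p != p' -> u p - u p' != 0.
  by move: gaps_pt; rewrite rmorph_prod => /prodf_neq0/(_ (p, p')); rewrite /= mevalB.
pose w iq := diff_prod u (cox_edges d k iq).
case/eqP: P'pt.
have -> : (mmap (@mpolyC _ L) (cox_family k v) P').@[pt] =
    P'.@[fun j => w (enum_val j)].
  apply: (etrans (@meval_mmap L L _ _ idfun _ pt P')).
  by apply: mmap_ext => // j; rewrite (rmorph_cox_family (meval pt)).
rewrite P'E; apply: P_image.
have wE i q := diff_prod_cox_edges k u i q.
pose lam i := u (pt_lam r s d i) - u None.
pose mu i := u (pt_mu r s d i) - u None.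
pose c q := u (pt_coef d n q) - u None.
pose t i := u (pt_time r s d i).
pose rho q l := u (pt_root n q l).
have -> : X w = \matrix_i \row_j proj_coord (cox_value k lam mu c t rho i) j.
  apply/matrixP => i j; rewrite !mxE; apply: proj_coord_ext => q; exact: wE.
have -> : Y w = \matrix_i \row_j cox_value k lam mu c t rho i (Yc j).
  by apply/matrixP => i j; rewrite !mxE; apply: wE.
apply: cox_curve_in_image => //.
- by move=> q; apply: u_neq.
- move=> q q' l l' qq'; rewrite -subr_eq0; apply: u_neq.
  by apply: contra_neq qq' => -[].
- move=> i i' /eqP tii'; apply/eqP; apply: contraLR tii' => ii'.
  by rewrite -subr_eq0; apply: u_neq; apply: contra_neq ii' => -[].
- by move=> i; apply: u_neq.
- by move=> i; apply: u_neq.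
Qed.

(** * Multihomogeneous equations from relations *)

Lemma mmap1_sum (S : comNzRingType) (n D : nat) (theta : 'I_n -> S)
    (wt : 'I_D -> 'X_{1..n}) (m : 'X_{1..D}) :
  mmap1 theta (\sum_j (wt j *+ m j))%MM = mmap1 (fun j => mmap1 theta (wt j)) m.
Proof.
have mmap1D k k' : mmap1 theta (k + k')%MM = mmap1 theta k * mmap1 theta k'.
  by apply: commr_mmap1_M => i x; apply: mulrC.
rewrite [RHS]/mmap1; elim/big_rec2: _ => [|j k p _ IH]; first exact: mmap11.
rewrite mmap1D IH; congr (_ * _).
elim: (m j) => [|e IHe]; first by rewrite mulm0n mmap11 expr0.
by rewrite mulmS mmap1D IHe exprS.
Qed.

Definition homog_component (F : fieldType) (D n : nat) (wt : 'I_D -> 'X_{1..n})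
    (g : 'X_{1..n}) (P : {mpoly F[D]}) : {mpoly F[D]} :=
  \sum_(m <- msupp P | (\sum_j (wt j *+ m j))%MM == g) P@_m *: 'X_[m].

Lemma mcoeff_homog_component (F : fieldType) (D n : nat) (wt : 'I_D -> 'X_{1..n})
    (g : 'X_{1..n}) (P : {mpoly F[D]}) (m : 'X_{1..D}) :
  (homog_component wt g P)@_m =
  if (\sum_j (wt j *+ m j))%MM == g then P@_m else 0.
Proof.
rewrite raddf_sum /= big_mkcond /=; have [mP|mP] := boolP (m \in msupp P).
  rewrite (bigD1_seq m) ?msupp_uniq //= [X in _ + X]big1 => [|m' ne].
    by rewrite mcoeffZ mcoeffX eqxx mulr1 addr0.
  by case: ifP => // _; rewrite mcoeffZ mcoeffX (negPf ne) mulr0.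
rewrite (memN_msupp_eq0 mP) if_same big_seq.
apply: big1 => m' m'P.
case: ifP => // _; rewrite mcoeffZ mcoeffX; case: eqP => [E|_]; rewrite ?mulr0 //.
by rewrite -E m'P in mP.
Qed.

(** If P vanishes on a set stable under a torus, then for w in this set
    theta -> P(theta w) is the zero polynomial, and its coefficients are the values
    at w of the homogeneous components of P. *)
Lemma homog_component_vanishes (F : fieldType) (L : closedFieldType)
    (iota : {rmorphism F -> L}) (D n : nat) (wt : 'I_D -> 'X_{1..n})
    (S : ('I_D -> L) -> Prop) (P : {mpoly F[D]}) :
  (forall w theta, S w -> S (fun j => mmap1 theta (wt j) * w j)) ->
  (forall w, S w -> mmap iota w P = 0) ->
  forall g w, S w -> mmap iota w (homog_component wt g P) = 0.
Proof.
move=> S_stable S_P g w Sw.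
pose Q : {mpoly L[n]} :=
  \sum_(m <- msupp P) (iota P@_m * mmap1 w m) *: 'X_[\sum_j (wt j *+ m j)].
have Q0 : Q = 0.
  apply/eqP/negPn/negP => /mpoly_nonzero_point[theta /eqP[]].
  rewrite -[RHS](S_P _ (S_stable _ theta Sw)) raddf_sum; apply: eq_bigr => m _.
  rewrite /= mevalZ mevalX -[\prod_(i < n) _]/(mmap1 theta _) mmap1_sum -mulrA.
  congr (_ * _); rewrite mulrC -big_split /=.
  by apply: eq_bigr => j _; rewrite exprMn.
have := congr1 (mcoeff g) Q0; rewrite raddf_sum mcoeff0 => <-.
rewrite rmorph_sum /= big_mkcond; apply: eq_bigr => m _ /=.
rewrite mcoeffZ mcoeffX; case: eqP => _; last by rewrite mulr0.
by rewrite mmapZ mmapX mulr1.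
Qed.

Lemma msupp_mmap_monomials (F : fieldType) (D N : nat) (hm : 'I_D -> 'X_{1..N})
    (P : {mpoly F[D]}) (u : 'X_{1..N}) :
  u \in msupp (mmap (@mpolyC N F) (fun j => 'X_[hm j]) P) ->
  exists2 m, m \in msupp P & u = (\sum_j (hm j *+ m j))%MM.
Proof.
rewrite mcoeff_msupp raddf_sum /= => nz.
have /hasP[m mP /eqP uE] :
    has (fun m : 'X_{1..D} => u == (\sum_j (hm j *+ m j))%MM) (msupp P).
  apply: contraNT nz => /hasPn no_m; rewrite big_seq big1 // => m /no_m ne.
  rewrite mcoeffCM (_ : mmap1 _ m = 'X_[\sum_j (hm j *+ m j)]).
    by rewrite mcoeffX eq_sym (negPf ne) mulr0.
  rewrite mpolyXE_id -[RHS]/(mmap1 _ _) mmap1_sum; apply: mmap1_eq => j.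
  by rewrite mmap1_id.
by exists m.
Qed.

Lemma mxvec_index_eq (m n : nat) (i i' : 'I_m) (j j' : 'I_n) :
  (mxvec_index i j == mxvec_index i' j') = (i == i') && (j == j').
Proof.
by rewrite (inj_eq (@cast_ord_inj _ _ _)) (inj_eq enum_rank_inj) xpair_eqE.
Qed.

Section Homogenization.

Variables (r s d k n : nat).
Hypothesis hrs : (s.+2 <= r)%N.

Let sr : (s <= r)%N. Proof. by apply: leq_trans hrs; rewrite leqW. Qed.
Lemma codim_gt0 : (0 < r - s)%N. Proof. by rewrite subn_gt0 (leq_trans _ hrs). Qed.
Let j0 : 'I_(r - s) := Ordinal codim_gt0.

Definition x_var (i : 'I_n) (j : 'I_r.+1) : 'I_(n * (r.+1 + (r - s))) :=
  mxvec_index i (lshift (r - s) j).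
Definition y_var (i : 'I_n) (j : 'I_(r - s)) : 'I_(n * (r.+1 + (r - s))) :=
  mxvec_index i (rshift r.+1 j).

Definition cox_weight (j : 'I_#|cox_coord n r s|) : 'X_{1..n + n} :=
  let: (i, q) := enum_val j in
  (U_(lshift n i) *+ x_scaled q + U_(rshift n i) *+ y_scaled q)%MM.

(** The substitution X_j := x_j y_0, E := x_(s+1), Y_j := y_j, which is the inverse of
    the Cox parametrization up to the rescaling lambda := y_0 lambda; it turns
    Cox-homogeneous polynomials into multihomogeneous ones without denominators. *)
Definition chart_monomial (j : 'I_#|cox_coord n r s|) :
    'X_{1..n * (r.+1 + (r - s))} :=
  let: (i, q) := enum_val j in
  match q with
  | inl j => (U_(x_var i (base_idx r j)) + U_(y_var i j0))%MM
  | inr None => U_(x_var i (normal_idx j0))%MM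
  | inr (Some j) => U_(y_var i j)%MM
  end.

Definition x_degree (i : 'I_n) (m : 'X_{1..n * (r.+1 + (r - s))}) : nat :=
  \sum_(j < r.+1) m (mxvec_index i (lshift (r - s) j)).
Definition y_degree (i : 'I_n) (m : 'X_{1..n * (r.+1 + (r - s))}) : nat :=
  \sum_(j < r - s) m (mxvec_index i (rshift r.+1 j)).

Lemma x_degree_chart i j :
  x_degree i (chart_monomial j) = cox_weight j (lshift n i).
Proof.
have xx i' j' : x_degree i U_(x_var i' j')%MM = (i' == i).
  rewrite /x_degree; have [->|ne] := eqVneq i' i; last first.
    by rewrite big1 // => e _; rewrite mnm1E mxvec_index_eq (negPf ne).
  rewrite (bigD1 j') //= mnm1E eqxx big1 ?addn0 // => e ne.
  by rewrite mnm1E mxvec_index_eq eqxx (inj_eq (@lshift_inj _ _)) eq_sym (negPf ne).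
have xy i' j' : x_degree i U_(y_var i' j')%MM = 0%N.
  rewrite /x_degree big1 // => e _.
  by rewrite mnm1E mxvec_index_eq [rshift _ _ == _]eq_sym eq_lrshift andbF.
have xD m m' : x_degree i (m + m')%MM = (x_degree i m + x_degree i m')%N.
  by rewrite -big_split; apply: eq_bigr => e _; rewrite mnmDE.
rewrite /chart_monomial /cox_weight; case: (enum_val j) => i' [j'|[j'|]];
  rewrite !mnmDE !mulmnE !mnm1E ?xD ?xx ?xy eq_lshift [rshift _ _ == _]eq_sym
          eq_lrshift /= ?muln1 ?muln0 ?addn0 //.
Qed.

Lemma y_degree_chart i j :
  y_degree i (chart_monomial j) = cox_weight j (rshift n i).
Proof.
have yy i' j' : y_degree i U_(y_var i' j')%MM = (i' == i).
  rewrite /y_degree; have [->|ne] := eqVneq i' i; last first.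
    by rewrite big1 // => e _; rewrite mnm1E mxvec_index_eq (negPf ne).
  rewrite (bigD1 j') //= mnm1E eqxx big1 ?addn0 // => e ne.
  by rewrite mnm1E mxvec_index_eq eqxx (inj_eq (@rshift_inj _ _)) eq_sym (negPf ne).
have yx i' j' : y_degree i U_(x_var i' j')%MM = 0%N.
  by rewrite /y_degree big1 // => e _; rewrite mnm1E mxvec_index_eq eq_lrshift andbF.
have yD m m' : y_degree i (m + m')%MM = (y_degree i m + y_degree i m')%N.
  by rewrite -big_split; apply: eq_bigr => e _; rewrite mnmDE.
rewrite /chart_monomial /cox_weight; case: (enum_val j) => i' [j'|[j'|]];
  rewrite !mnmDE !mulmnE !mnm1E ?yD ?yy ?yx eq_rshift eq_lrshift
          /= ?muln1 ?muln0 ?addn0 //.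
Qed.

Definition homogenized (F : fieldType) (P : {mpoly F[#|cox_coord n r s|]}) :
    {mpoly F[n * (r.+1 + (r - s))]} :=
  mmap (@mpolyC _ F) (fun j => 'X_[chart_monomial j]) P.

(** Each chart monomial has the bidegree prescribed by the Cox grading. *)
Lemma homogenized_multihomog (F : fieldType) (P : {mpoly F[#|cox_coord n r s|]})
    (g : 'X_{1..n + n}) :
  multihomog (fun i => g (lshift n i)) (fun i => g (rshift n i))
    (homogenized (homog_component cox_weight g P)).
Proof.
have sum_deg (deg : 'X_{1..n * (r.+1 + (r - s))} -> nat) (e : 'I_(n + n)) :
    deg 0%MM = 0%N -> (forall m m', deg (m + m')%MM = (deg m + deg m')%N) ->
    (forall j, deg (chart_monomial j) = cox_weight j e) ->
    forall m, deg (\sum_j (chart_monomial j *+ m j))%MM =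
              (\sum_j (cox_weight j *+ m j))%MM e.
  move=> deg0 degD deg_chart m; rewrite mnm_sumE.
  elim/big_rec2: _ => [|j u v _ <-]; first exact: deg0.
  rewrite degD mulmnE -deg_chart; congr (_ + _)%N.
  elim: (m j) => [|l IH]; first by rewrite mulm0n muln0.
  by rewrite mulmS degD IH mulnS.
move=> _ /msupp_mmap_monomials[m mP ->] i.
have /eqP gE : (\sum_j (cox_weight j *+ m j))%MM == g.
  by move: mP; rewrite mcoeff_msupp mcoeff_homog_component; case: ifP; rewrite ?eqxx.
split.
- rewrite -gE; apply: (sum_deg (x_degree i)) => [|u v|j]; last exact: x_degree_chart.
  + by rewrite /x_degree big1 // => e _; rewrite mnm0E.
  + by rewrite -big_split; apply: eq_bigr => e _; rewrite mnmDE.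
- rewrite -gE; apply: (sum_deg (y_degree i)) => [|u v|j]; last exact: y_degree_chart.
  + by rewrite /y_degree big1 // => e _; rewrite mnm0E.
  + by rewrite -big_split; apply: eq_bigr => e _; rewrite mnmDE.
Qed.

Definition chart_value (L : fieldType) (x : 'M[L]_(n, r.+1)) (y : 'M[L]_(n, r - s))
    (i : 'I_n) (q : cox_index r s) : L :=
  match q with
  | inl j => x i (base_idx r j) * y i j0
  | inr None => x i (normal_idx j0)
  | inr (Some j) => y i j
  end.

Lemma homogenized_vanishes_at (F L : fieldType) (iota : {rmorphism F -> L})
    (P : {mpoly F[#|cox_coord n r s|]}) (x : 'M[L]_(n, r.+1)) (y : 'M[L]_(n, r - s)) :
  vanishes_at iota (homogenized P) x y <->
  mmap iota (fun j => chart_value x y (enum_val j).1 (enum_val j).2) P = 0.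
Proof.
rewrite /vanishes_at meval_map_mpoly rmorph_mmap.
rewrite (_ : mmap (_ \o _) _ P =
  mmap iota (fun j => chart_value x y (enum_val j).1 (enum_val j).2) P) //.
apply: mmap_ext => [c|j]; first by rewrite /= mmapC.
have mmap1D (v : 'I_(n * (r.+1 + (r - s))) -> L) m m' :
    mmap1 v (m + m')%MM = mmap1 v m * mmap1 v m'.
  by apply: commr_mmap1_M => i z; apply: mulrC.
rewrite /= mmapX /chart_monomial; case: (enum_val j) => i [j'|[j'|]] /=.
- by rewrite mmap1D !mmap1U !mxvecE row_mxEl row_mxEr.
- by rewrite mmap1U mxvecE row_mxEr.
- by rewrite mmap1U mxvecE row_mxEl.
Qed.

End Homogenization.

(** * Cox coordinates of a given curve *)

(** H(u + T v) as a polynomial in T. *)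
Definition restrict_to_line (L : fieldType) (n : nat) (u v : 'I_n -> L)
    (H : {mpoly L[n]}) : {poly L} :=
  mmap (@polyC L) (fun e => (u e)%:P + v e *: 'X) H.

Lemma restrict_to_line_eval (L : fieldType) (n : nat) (u v : 'I_n -> L)
    (H : {mpoly L[n]}) (t : L) :
  (restrict_to_line u v H).[t] = H.@[fun e => u e + t * v e].
Proof.
rewrite -[LHS]/(horner_eval t _) rmorph_mmap.
apply: mmap_ext => [c|e]; rewrite /= /horner_eval ?hornerC //.
by rewrite hornerD hornerC hornerZ hornerX mulrC.
Qed.

Lemma coef_top_mul (R : nzRingType) (p q : {poly R}) (m m' : nat) :
  (size p <= m.+1)%N -> (size q <= m'.+1)%N -> (p * q)`_(m + m') = p`_m * q`_m'.
Proof.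
move=> sp sq; have lt : (m < (m + m').+1)%N by rewrite ltnS leq_addr.
rewrite coefM (bigD1 (Ordinal lt)) //= addKn big1 ?addr0 // => j /eqP jm.
have [gt|le] := ltnP m j; first by rewrite nth_default ?mul0r // (leq_trans sp).
rewrite [q`__]nth_default ?mulr0 // (leq_trans sq) //.
have : (j : nat) <> m by move=> E; apply: jm; apply: val_inj.
by lia.
Qed.

(** A form of degree m that does not vanish at the direction v restricts to a
    polynomial of degree exactly m: no root is at infinity. *)
Lemma restrict_to_line_top (L : fieldType) (n m : nat) (u v : 'I_n -> L)
    (H : {mpoly L[n]}) :
  H \is m.-homog ->
  (size (restrict_to_line u v H) <= m.+1)%N /\
  (restrict_to_line u v H)`_m = H.@[v].
Proof.
move=> /dhomogP Hm.
pose top k (p : {poly L}) b := (size p <= k.+1)%N /\ p`_k = b.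
have topM k k' p p' b b' : top k p b -> top k' p' b' -> top (k + k')%N (p * p') (b * b').
  move=> [sp <-] [sp' <-]; split; last exact: coef_top_mul.
  by apply: leq_trans (size_polyMleq _ _) _; lia.
have top_mon k : top (mdeg k) (mmap1 (fun e => (u e)%:P + v e *: 'X) k)
    (\prod_e v e ^+ k e).
  rewrite mdegE /mmap1; elim/big_rec3: _ => [|e b p l _ IH].
    by split; rewrite ?size_poly1 ?coefC.
  apply: (topM) IH; elim: (k e) => [|j IHj]; first by split; rewrite ?size_poly1 ?coefC.
  rewrite !exprS -add1n; apply: (topM) IHj; split.
    apply: leq_trans (size_polyD _ _) _; rewrite geq_max.
    rewrite (leq_trans (size_polyC_leq1 _)) //.
    by rewrite (leq_trans (size_scale_leq _ _)) // size_polyX.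
  by rewrite coefD coefC coefZ coefX mulr1 add0r.
have top_sum (s : seq 'X_{1..n}) : {subset s <= msupp H} ->
    top m (\sum_(k <- s) (H@_k)%:P * mmap1 (fun e => (u e)%:P + v e *: 'X) k)
          (\sum_(k <- s) H@_k * \prod_e v e ^+ k e).
  elim: s => [|k s IH] sH.
    by rewrite !big_nil; split; rewrite ?size_poly0 ?coef0.
  have [|s1 c1] := IH; first by move=> k' k's; apply: sH; rewrite inE k's orbT.
  have [s2 c2] := top_mon k; rewrite (Hm k) ?sH ?mem_head // in s2 c2.
  rewrite !big_cons; split; last by rewrite coefD coefCM c2 c1.
  apply: leq_trans (size_polyD _ _) _; rewrite geq_max s1 andbT.
  by rewrite mul_polyC (leq_trans (size_scale_leq _ _)).
by have [] := top_sum (msupp H) (fun _ => id); rewrite -mevalE.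
Qed.

Lemma dhomog_eval_scale (L : fieldType) (n m : nat) (H : {mpoly L[n]}) (a : L)
    (v : 'I_n -> L) :
  H \is m.-homog -> H.@[fun e => a * v e] = a ^+ m * H.@[v].
Proof.
move=> /dhomogP Hm; rewrite !mevalE mulr_sumr !big_seq; apply: eq_bigr => k kH.
rewrite mulrCA; congr (_ * _); rewrite -(Hm k kH) [mf in _ ^+ mf]mdegE.
rewrite -prodrXr -big_split /=.
by apply: eq_bigr => e _; rewrite exprMn.
Qed.

Lemma split_univariate (L : closedFieldType) (p : {poly L}) (m d : nat) :
  (m <= d)%N -> p = 0 \/ size p = m.+1 ->
  exists crho : L * ('I_d -> L), forall t,
    p.[t] = crho.1 * \prod_(l < d | (l < m)%N) (t - crho.2 l).
Proof.
move=> md [->|sp].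
  by exists (0, fun=> 0) => t; rewrite horner0 mul0r.
have [zs pE] := closed_field_poly_normal p.
have p0 : lead_coef p != 0 by rewrite lead_coef_eq0 -size_poly_eq0 sp.
have szs : size zs = m.
  by have := sp; rewrite pE size_scale // size_prod_XsubC => -[].
exists (lead_coef p, fun l : 'I_d => zs`_l) => t.
rewrite {1}pE hornerZ horner_prod; congr (_ * _).
rewrite -(big_ord_widen d (fun l => t - zs`_l) md) (big_nth 0) szs big_mkord.
by apply: eq_bigr => l _; rewrite hornerXsubC.
Qed.

Lemma ord2_cases (e : 'I_2) : e = 0 \/ e = 1.
Proof.
by case: e => [[|[|e]] lt] //; [left|right]; apply: val_inj.
Qed.

Lemma generic_direction (L : closedFieldType) (I J : finType) (z : I -> 'rV[L]_2)
    (H : J -> {mpoly L[2]}) :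
  (forall i, z i != 0) ->
  exists v : 'I_2 -> L,
    [/\ v 1 != 0, forall i, z i 0 0 * v 1 - z i 0 1 * v 0 != 0 &
        forall j, H j != 0 -> (H j).@[v] != 0].
Proof.
move=> z0.
pose lin i : {mpoly L[2]} := z i 0 0 *: 'X_1 - z i 0 1 *: 'X_0.
have lin0 i : lin i != 0.
  apply: contraNneq (z0 i) => lin_i0; apply/eqP/rowP => e; rewrite mxE.
  have := congr1 (meval (fun e => (e == 0)%:R)) lin_i0.
  have := congr1 (meval (fun e => (e == 1)%:R)) lin_i0.
  rewrite !meval0 !mevalB !mevalZ !mevalXU eqxx /= !mulr1 !mulr0 subr0 sub0r.
  move=> z0E /eqP; rewrite oppr_eq0 => /eqP z1E.
  by case: (ord2_cases e) => ->.
have [|v] := @mpoly_nonzero_point L 2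
   ('X_1 * \prod_i lin i * \prod_(j | H j != 0) H j).
  rewrite !mulf_neq0 //; last by apply/prodf_neq0 => j.
    by apply/eqP => /(congr1 (mcoeff U_(1)))/eqP; rewrite mcoeffX eqxx mcoeff0 oner_eq0.
  by apply/prodf_neq0 => i _; apply: lin0.
rewrite !mevalM !mulf_eq0 !negb_or !rmorph_prod /= => /andP[/andP[v1 /prodf_neq0 vz]].
move=> /prodf_neq0 vH; exists v; split=> //.
- by rewrite mevalXU in v1.
- by move=> i; have := vz i isT; rewrite mevalB !mevalZ !mevalXU.
Qed.

(** Choose the point at infinity of P^1 away from the marked points and from the
    zeros of all nonzero forms.  In the affine coordinate T every nonzero form has
    full degree and splits.  The equations of the blow-up and the absence of
    common zeros of the G_j give the form E as the common quotient of F by G. *)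
Lemma image_cox_values (L : closedFieldType) (r s d k n : nat)
    (x : 'M[L]_(n, r.+1)) (y : 'M[L]_(n, r - s)) :
  (s.+2 <= r)%N -> (k < d)%N -> in_ev_image d k x y ->
  exists (lam mu : 'I_n -> L) (c : cox_index r s -> L) (t : 'I_n -> L)
         (rho : cox_index r s -> 'I_d -> L),
  forall i, (forall j, x i j = proj_coord (cox_value k lam mu c t rho i) j) /\
            (forall j, y i j = cox_value k lam mu c t rho i (Yc j)).
Proof.
move=> hrs hdk [F [G [z [[Fd Gd FG] [z0 _] xy]]]].
have sr : (s <= r)%N by apply: leq_trans hrs; rewrite leqW.
pose H (q : 'I_r.+1 + 'I_(r - s)) := match q with inl j => F j | inr j => G j end.
have [v [v1 vz vH]] := generic_direction H z0.
(* det(u, v) = 1, so z = det(z, v) u + (z_1 / v_1) v for every z. *)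
pose u (e : 'I_2) : L := if e == 0 then (v 1)^-1 else 0.
pose f j := restrict_to_line u v (F j).
pose g j := restrict_to_line u v (G j).
have sizeE (q : 'I_r.+1 + 'I_(r - s)) m : H q \is m.-homog ->
    restrict_to_line u v (H q) = 0 \/ size (restrict_to_line u v (H q)) = m.+1.
  move=> Hm; have [H0|H0] := eqVneq (H q) 0.
    by left; rewrite H0 /restrict_to_line rmorph0.
  have [le_size top] := restrict_to_line_top u v Hm.
  right; apply/eqP; rewrite eqn_leq le_size ltnNge.
  apply: contraNN (vH q H0) => /leq_sizeP/(_ m (leqnn m)).
  by rewrite top => ->.
have f_size j : f j = 0 \/ size (f j) = d.+1 := sizeE (inl j) d (Fd j).
have g_size j : g j = 0 \/ size (g j) = (d - k).+1 := sizeE (inr j) (d - k)%N (Gd j).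
have blow t : blowup_pt (eval_forms F (\row_e (u e + t * v e)))
                        (eval_forms G (\row_e (u e + t * v e))).
  apply: FG; apply/eqP => /rowP line0.
  have := line0 1; rewrite !mxE /u /= add0r => /eqP.
  rewrite mulf_eq0 (negPf v1) orbF => /eqP t0.
  have := line0 0; rewrite !mxE /u /= t0 mul0r addr0 => /eqP.
  by rewrite invr_eq0 (negPf v1).
have fE j t : (eval_forms F (\row_e (u e + t * v e))) 0 j = (f j).[t].
  by rewrite mxE restrict_to_line_eval; apply: meval_eq => e; rewrite mxE.
have gE j t : (eval_forms G (\row_e (u e + t * v e))) 0 j = (g j).[t].
  by rewrite mxE restrict_to_line_eval; apply: meval_eq => e; rewrite mxE.
have [] := @common_quotient L 'I_(r - s) (fun j => f (normal_idx j)) g.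
- move=> t; have [_ g0 _] := blow t; apply/existsP; apply: contraNT g0.
  rewrite negb_exists => /forallP gt0; apply/eqP/rowP => j; rewrite gE mxE.
  by apply/eqP; rewrite -[_ == _]negbK gt0.
- move=> i j; apply: poly_ext_closed => t; rewrite !hornerM -!fE -!gE.
  by have [_ _] := blow t; apply.
move=> e eE.
have e_size : e = 0 \/ size e = k.+1.
  have [_ g0 _] := blow 0.
  have [j gj] : exists j, g j != 0.
    apply/existsP; apply: contraNT g0; rewrite negb_exists => /forallP g0.
    by apply/eqP/rowP => j; rewrite gE mxE; have := g0 j; rewrite negbK => /eqP->;
       rewrite horner0.
  have [->|e0] := eqVneq e 0; [by left|right].
  have fj : f (normal_idx j) != 0 by rewrite eE mulf_neq0.
  have [/eqP|] := f_size (normal_idx j); first by rewrite (negPf fj).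
  have [/eqP|gsz] := g_size j; first by rewrite (negPf gj).
  rewrite eE size_mul // gsz addnS /=.
  by move: (size e) => se; clear -hdk; lia.
pose h (q : cox_index r s) : {poly L} := match q with
  | inl j => f (base_idx r j) | inr None => e | inr (Some j) => g j end.
have crho_ex q : exists cr : L * ('I_d -> L), forall t, (h q).[t] =
    cr.1 * \prod_(l < d | (l < cox_degree d k q)%N) (t - cr.2 l).
  apply: split_univariate.
    by case: q => [?|[?|]] //=; rewrite ?leq_subr // ltnW.
  by case: q => [?|[?|]] /=; [apply: f_size | apply: g_size | apply: e_size].
have [crho crhoE] := choice crho_ex.
have kap_ex i : exists kap : L * L,
    [/\ kap.2 != 0, row i x = kap.1 *: eval_forms F (row i z) &
        row i y = kap.2 *: eval_forms G (row i z)].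
  by have [[a _ xE] [b b0 yE]] := xy i; exists (a, b).
have [kap kapE] := choice kap_ex.
pose ht i := row i z 0 0 * v 1 - row i z 0 1 * v 0.
pose t i := row i z 0 1 / v 1 / ht i.
have zE i e' : row i z 0 e' = ht i * (u e' + t i * v e').
  have := vz i; case: (ord2_cases e') => -> ht0; rewrite /u /t /ht /=; field.
    by rewrite v1 ht0.
  by rewrite v1 ht0.
have FE i j : x i j = (kap i).1 * (ht i ^+ d * (f j).[t i]).
  have [_ /rowP/(_ j) + _] := kapE i; rewrite !mxE => ->.
  rewrite restrict_to_line_eval -dhomog_eval_scale //.
  by congr (_ * _); apply: meval_eq => e'; rewrite -zE.
have GE i j : y i j = (kap i).2 * (ht i ^+ (d - k) * (g j).[t i]).
  have [_ _ /rowP/(_ j)] := kapE i; rewrite !mxE => ->.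
  rewrite restrict_to_line_eval -dhomog_eval_scale //.
  by congr (_ * _); apply: meval_eq => e'; rewrite -zE.
exists (fun i => (kap i).1 / (kap i).2 * ht i ^+ k).
exists (fun i => (kap i).2 * ht i ^+ (d - k)).
exists (fun q => (crho q).1), t, (fun q => (crho q).2) => i.
have [kap0 _ _] := kapE i.
split=> j; last by rewrite GE /cox_value -crhoE /= expr0 expr1 mul1r mulrA.
rewrite (@proj_coord_scaled _ _ _ _ _ (fun q => (crho q).1 *
   \prod_(l < d | (l < cox_degree d k q)%N) (t i - (crho q).2 l))).
transitivity ((kap i).1 * ht i ^+ d * proj_coord (fun q => (h q).[t i]) j).
  rewrite FE; have [[j' ->]|[j' ->]] := proj_idxP j sr.
    by rewrite proj_coord_base // mulrA.
  by rewrite proj_coord_normal eE hornerM mulrA.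
congr (_ * _); last by apply: proj_coord_ext => q; rewrite -crhoE.
rewrite -[in LHS](subnKC (ltnW hdk)) exprD.
by field.
Qed.

(** * Dominance as algebraic independence *)

(** A relation between generic Cox coordinates holds at all parameters, including
    the degenerate ones where forms vanish or roots collide. *)
Lemma relation_specializes (F L : fieldType) (iota : {rmorphism F -> L})
    (r s d k n : nat) (P : {mpoly F[#|cox_coord n r s|]})
    (lam mu : 'I_n -> L) (c : cox_index r s -> L) (t : 'I_n -> L)
    (rho : cox_index r s -> 'I_d -> L) :
  mmap (@mpolyC _ F) (cox_family k (@generic_point F r s d n)) P = 0 ->
  mmap iota (fun j => cox_value k lam mu c t rho (enum_val j).1 (enum_val j).2) P = 0.
Proof.
move=> P0.
pose beta (e : 'I_#|cox_var r s d n|) : L :=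
  match enum_val e with
  | inl (inl i) => t i
  | inl (inr (inl i)) => lam i
  | inl (inr (inr i)) => mu i
  | inr (inl q) => c q
  | inr (inr (q, l)) => rho q l
  end.
rewrite -(rmorph0 (mmap iota beta)) -P0 rmorph_mmap.
apply: mmap_ext => [e|j]; first by rewrite /= mmapC.
rewrite /= (rmorph_cox_family (mmap iota beta)) /cox_family.
case: (enum_val j) => i q; rewrite diff_prod_cox_edges /= rmorph0.
rewrite /cox_value !mmapX !mmap1U /beta !enum_rankK !subr0.
congr (_ * (_ * _)); apply: eq_bigr => l _.
by rewrite !mmapX !mmap1U !enum_rankK.
Qed.

(** A relation P, reduced to one homogeneous component and written in the
    coordinates x, y, would be a multihomogeneous equation of the image.  By
    dominance it would vanish on the whole product of blow-ups, where the Cox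
    coordinates take arbitrary nonzero values; so P = 0. *)
Lemma dominant_independent (F : fieldType) (L : closedFieldType)
    (iota : {rmorphism F -> L}) (r s d k n : nat) :
  (s.+2 <= r)%N -> (k < d)%N -> ev_dominant iota r s d k n ->
  cox_independent F r s d k n.
Proof.
move=> hrs hdk dom P P_rel; apply/eqP/negPn/negP => P0.
have sr : (s <= r)%N by apply: leq_trans hrs; rewrite leqW.
have [m0 m0P] : exists m0, m0 \in msupp P.
  by move: P0; rewrite -msupp_eq0; case: (msupp P) => // m ms _; exists m; apply: mem_head.
set wt := @cox_weight r s n.
pose g := (\sum_j (wt j *+ m0 j))%MM.
pose C := homog_component wt g P.
pose S (w : 'I_#|cox_coord n r s| -> L) := exists lam mu c t rho,
  forall j, w j = @cox_value L r s d k n lam mu c t rho (enum_val j).1 (enum_val j).2.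
have C_S w : S w -> mmap iota w C = 0.
  apply: homog_component_vanishes => [{}w theta|{}w].
    move=> [lam [mu [c [t [rho wE]]]]].
    exists (fun i => theta (lshift n i) * lam i), (fun i => theta (rshift n i) * mu i).
    exists c, t, rho => j; rewrite wE /wt /cox_weight /cox_value.
    case: (enum_val j) => i q /=; rewrite !exprMn.
    have mmap1D m m' : mmap1 theta (m + m')%MM = mmap1 theta m * mmap1 theta m'.
      by apply: commr_mmap1_M => e z; apply: mulrC.
    have mmap1b m (b : bool) : mmap1 theta (m *+ b)%MM = mmap1 theta m ^+ b.
      by case: b; rewrite ?mulm1n ?mulm0n ?mmap11.
    rewrite mmap1D !mmap1b !mmap1U; ring.
  move=> [lam [mu [c [t [rho wE]]]]].
  rewrite -[RHS](relation_specializes iota lam mu c t rho P_rel).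
  exact: mmap_ext.
pose Q := homogenized hrs C.
have Q_image x y : in_ev_image d k x y -> vanishes_at iota Q x y.
  move=> /(image_cox_values hrs hdk)[lam [mu [c [t [rho xyE]]]]].
  apply/homogenized_vanishes_at; apply: C_S.
  pose y0 i := y i (Ordinal (codim_gt0 hrs)).
  (* The factor y_0 in the chart monomials is absorbed by lambda. *)
  exists (fun i => y0 i * lam i), mu, c, t, rho => j.
  case: (enum_val j) => i [j'|[j'|]] /=; have [xE yE] := xyE i.
  - by rewrite xE proj_coord_base // -/(y0 i) /cox_value /=; ring.
  - by rewrite yE /cox_value /= !expr0.
  - rewrite xE proj_coord_normal -yE -/(y0 i) /cox_value /=; ring.
have Q_all := dom _ _ Q (@homogenized_multihomog r s n hrs F P g) Q_image.
have C0 : map_mpoly iota C != 0.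
  apply: contraTneq m0P => /(congr1 (mcoeff m0))/eqP.
  rewrite mcoeff_map_mpoly mcoeff_homog_component eqxx mcoeff0 fmorph_eq0.
  by rewrite mcoeff_msupp negbK.
(* All coordinates are asked to be nonzero: E will be a quotient by Y_0, and the
   chosen point must be a point of the blow-up. *)
have [|v] := @mpoly_nonzero_point L _ (map_mpoly iota C * \prod_j 'X_j).
  rewrite mulf_neq0 //; apply/prodf_neq0 => j _.
  by apply/eqP => /(congr1 (mcoeff U_(j)))/eqP; rewrite mcoeffX eqxx mcoeff0 oner_eq0.
rewrite mevalM mulf_eq0 negb_or rmorph_prod => /andP[Cv /prodf_neq0 v0].
pose w i q := v (enum_rank ((i, q) : cox_coord n r s)).
have w0 i q : w i q != 0 by have := v0 (enum_rank ((i, q) : cox_coord n r s)) isT; rewrite /= mevalXU.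
pose j0 := Ordinal (codim_gt0 hrs).
pose w' i (q : cox_index r s) :=
  if q is inr (Some _) then w i q else w i q / w i (Yc j0).
pose x := \matrix_i \row_j proj_coord (w' i) j : 'M[L]_(n, r.+1).
pose y := \matrix_i \row_j w i (Yc j) : 'M[L]_(n, r - s).
have xy i : blowup_pt (row i x) (row i y).
  split.
  - apply/eqP => /rowP/(_ (base_idx r (0 : 'I_s.+1)))/eqP.
    by rewrite !mxE proj_coord_base // mulf_eq0 invr_eq0 !(negPf (w0 _ _)).
  - by apply/eqP => /rowP/(_ j0)/eqP; rewrite !mxE (negPf (w0 _ _)).
  - by move=> j j'; rewrite !mxE !proj_coord_normal mulrAC.
case/eqP: Cv; rewrite meval_map_mpoly.
rewrite -[RHS]((homogenized_vanishes_at hrs iota C x y).1 (Q_all x y xy)).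
apply: mmap_ext => // j; rewrite -[in LHS](enum_valK j).
case: (enum_val j) => i [j'|[j'|]]; rewrite /= !mxE.
- by rewrite proj_coord_base // /w' divfK.
- by [].
- by rewrite proj_coord_normal /w' divfK.
Qed.

Lemma dominance_transfer (F F' : fieldType) (L L' : closedFieldType)
    (iota : {rmorphism F -> L}) (iota' : {rmorphism F' -> L'}) (r s d k n : nat) :
  (s.+2 <= r)%N -> (k < d)%N ->
  ev_dominant iota r s d k n -> ev_dominant iota' r s d k n.
Proof.
move=> hrs hdk dom; have indep := dominant_independent hrs hdk dom.
exact: (independent_dominant hrs hdk indep).
Qed.

Theorem proposition5p4p1
    (R : realType) (K : closedFieldType) (p : nat) (hp : p \in [pchar K])
    (r s d k n : nat) (hrs : (s.+2 <= r)%N) (hdk : (k < d)%N) :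
  (ev_dominant_closed R[i] r s d k n <-> ev_dominant_closed K r s d k n) /\
  (ev_dominant_closed R[i] r s d k n <-> ev_dominant_rat r s d k n).
Proof. by split; split; apply: dominance_transfer. Qed.
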